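(* Let $w=\sqrt2$ and $u=\sqrt2+1$. Then the $\mathbb{Z}[\sqrt2]$-points on the curve $$E(2+\sqrt2)\colon\quad 2+\sqrt2=uw=(a^2b+1)b$$ are $(a,b)=(0,wu)$ and the ten pairs $(\pm a,b)$ with $a,b$ as follows: $$\begin{aligned} b&=-u, & a&=-1;\\ b&=u, & a&=w-1=1/u;\\ b&=1/u^3, & a&=13+9w=(3+w)u^2;\\ b&=-u^5, & a&=31-22w=-(3-w)/u^3;\\ b&=w, & a&=1;\\ b&=-wu^2, & a&=1-w=-1/u;\\ b&=-w/u, & a&=-2-w=-wu;\\ b&=-wu^3, & a&=4-3w=-w/u^2;\\ b&=-w/u^{13}, & a&=-13wu^{10};\\ b&=-wu^{15}, & a&=-13w/u^{11}. \end{aligned}$$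
   Context: A $\mathbb{Z}[\sqrt2]$-point on the curve is a pair $(a,b)\in\mathbb{Z}[\sqrt2]^2$ satisfying the equation. *)

(* Defs.v *)
From mathcomp Require Import all_boot all_order all_algebra.
Set Implicit Arguments.
Unset Strict Implicit.
Unset Printing Implicit Defensive.

Import GRing.Theory Num.Theory.
Local Open Scope ring_scope.

(* The ring Z[sqrt 2], as the subset Z + Z sqrt 2 of an ambient real closed
   field R. *)
Definition Zsqrt2 (R : rcfType) (x : R) : Prop :=
  exists m n : int, x = m%:~R + n%:~R * Num.sqrt 2.

(* (a, b) lies on the curve E(c) : c = (a^2 b + 1) b. *)
Definition on_curve (R : rcfType) (c a b : R) : Prop :=
  c = (a ^+ 2 * b + 1) * b.

Definition Zsqrt2_point (R : rcfType) (c a b : R) : Prop :=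
  [/\ Zsqrt2 a, Zsqrt2 b & on_curve c a b].

(* Main.v *)
(* Put y = a b. Then b = 2 + w - y^2 divides 2 + w, which has norm 2, so the norm of
   2 + w - y^2 is 1, -1, 2 or -2. With y = p + q w this is one of four quartic equations in
   integers p, q.
   - Norm 1 is impossible modulo 4, and norm -2 leads to x^4 + 1 = 2 y^2, which Fermat's
     descent solves.
   - Norm -1 makes some Pell number of index 4 n pronic. A sieve leaves two residue classes
     of n, in which quadratic reciprocity for the Jacobi symbol excludes all n > 1.
   - Norm 2 leads to Ljunggren's equation x^2 + 1 = 2 y^4. Parametrising Pythagorean triples
     twice gives y = a^2 + b^2 where, after multiplication by 3 - 2 i and by units and 1 + i,
     the argument of a + b i is extremely close to arctan (1 / 239) / 4. Because
     239^2 + 1 = 2 13^4, the Pade approximants of (1 - x)^(1/4) at x = 2 i / (239 + i) are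
     good enough to force y < 10^16 (the method of Thue and Siegel, used for this equation
     by Chen). The remaining y^2 are among the first hundred Pell numbers. *)

(* With m = p^2 - 2 q^2, the norm N of 2 + w - y^2 satisfies m^2 = 4 ((p - q)^2 + q^2) - 2 + N, so
   the parity of p separates odd from even N. A linear substitution turns m, up to a factor -2 when
   p is even, into a form r^2 + 2 r q - q^2 (again called m), and m^2 becomes linear in h = r^2 +
   q^2. The companion n = r^2 - 2 r q - q^2 obeys m^2 + n^2 = 2 h^2. This one relation produces x^4
   + 1 = 2 y^2, the Pell equation and Ljunggren's equation from the three quartics. Ljunggren's
   equation has the large solution y = 13, coming from a + b i = 3 + 2 i. That solution is the base
   point of the approximation, which is why 3 - 2 i and 239 occur: (1 + i) (3 + 2 i)^4 = - 239 +
   i. *)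
Require Import Defs.
From Stdlib Require Import BinInt.
From Stdlib Require ZArith Znumtheory Lia List Reals Lra.
From Coquelicot Require Coquelicot.
From mathcomp Require all_boot all_order all_algebra.
From mathcomp Require ring lra zify ssrZ.

(** * The Jacobi symbol *)

Module Jacobi.

Import ZArith.
Import all_boot mathcomp.zify.zify.
Local Open Scope nat_scope.

(* [jacobi a n] is [true] when the Jacobi symbol (a | n) is -1. Gauss's lemma, here taken as the
   definition, makes sense for every odd n prime to a, so no factorisation is needed. *)
Definition jacobi (a n : nat) : bool :=
  odd (\sum_(i < n./2) (n./2 < (a * i.+1) %% n)).

Lemma jacobi_addb (a n : nat) :
  jacobi a n = \big[addb/false]_(x <- iota 1 n./2) (n./2 < (a * x) %% n).
Proof.
rewrite /jacobi (big_morph odd oddD (erefl : odd 0 = false)).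
rewrite -[iota 1 _]/(iota (1 + 0) _) iotaDl big_map.
rewrite -(big_mkord xpredT (fun i => odd (n./2 < (a * i.+1) %% n))) /index_iota subn0.
by apply: eq_bigr => i _; rewrite oddb.
Qed.

Lemma jacobi_mod (a b n : nat) : a = b %[mod n] -> jacobi a n = jacobi b n.
Proof.
move=> ab; rewrite /jacobi; congr odd; apply: eq_bigr => i _.
by rewrite -modnMml ab modnMml.
Qed.

(** * Gauss's lemma and multiplicativity *)

Section HalfSystem.

Variables (n b : nat).
Hypotheses (n_odd : odd n) (bn : coprime b n).

Let h := n./2.
(* the representative of b x or - b x modulo n in the half system 1, ..., h *)
Let fold x := let r := (b * x) %% n in if r <= h then r else n - r.

Lemma odd_halfE : n = h.*2.+1.
Proof. by rewrite -[LHS]odd_double_half n_odd. Qed.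

Lemma mulmod_gt0 x : 0 < x <= h -> 0 < (b * x) %% n.
Proof.
move=> xh; rewrite lt0n; apply/negP => /eqP /eqP; rewrite -/(dvdn _ _) Gauss_dvdr 1?coprime_sym //.
by move=> /dvdn_leq; have := odd_halfE; lia.
Qed.

Lemma fold_half x : 0 < x <= h -> 0 < fold x <= h.
Proof.
move=> xh; rewrite /fold; have r0 := mulmod_gt0 x xh.
have n0 : 0 < n by rewrite odd_halfE.
have rn := ltn_pmod (b * x) n0; have nE := odd_halfE.
by move: r0 rn; set r := (b * x) %% n => r0 rn; case: (leqP r h) => hr; lia.
Qed.

Lemma fold_inj x y : 0 < x <= h -> 0 < y <= h -> fold x = fold y -> x = y.
Proof.
move=> xh yh; have nE := odd_halfE; have n0 : 0 < n by rewrite odd_halfE.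
have rx := ltn_pmod (b * x) n0; have ry := ltn_pmod (b * y) n0.
have nb : coprime n b by rewrite coprime_sym.
have same : (b * x) %% n = (b * y) %% n -> x = y.
  wlog le : x y xh yh rx ry / x <= y.
    by move=> W E; case: (leqP x y) => [|/ltnW] le; [|symmetry]; apply: W.
  move/esym/eqP; rewrite eqn_mod_dvd ?leq_mul2l ?le ?orbT // -mulnBr Gauss_dvdr //.
  by move=> d; case: (posnP (y - x)) => [|p]; [lia|have := dvdn_leq p d; lia].
have opp : (b * x) %% n + (b * y) %% n = n -> x = y.
  move=> E; have : n %| b * x + b * y by rewrite /dvdn -modnDm E modnn.
  rewrite -mulnDr Gauss_dvdr // => /dvdn_leq; lia.
by rewrite /fold; case: leqP => h1; case: leqP => h2 E; first [apply: same; lia|apply: opp; lia].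
Qed.

Lemma jacobi_term a x : coprime a n -> 0 < x <= h ->
  (h < (a * b * x) %% n) = (h < (b * x) %% n) (+) (h < (a * fold x) %% n).
Proof.
move=> an xh; have nE := odd_halfE; have n0 : 0 < n by rewrite odd_halfE.
have fh := fold_half x xh; move: fh; rewrite /fold.
have rx := ltn_pmod (b * x) n0.
rewrite -mulnA -(modnMmr a (b * x)).
move: rx; set r := (b * x) %% n => rx.
case: (leqP r h) => h1 fh; first by rewrite addFb.
have E : (a * r + a * (n - r)) %% n = 0 by rewrite -mulnDr subnKC 1?ltnW // modnMl.
have ar : 0 < (a * r) %% n.
  rewrite lt0n; apply/negP => /eqP /eqP; rewrite -/(dvdn _ _) Gauss_dvdr 1?coprime_sym //.
  by move=> /dvdn_leq; lia.
move/eqP: E; rewrite -modnDm -/(dvdn _ _) => /dvdnP [[|[|k]] E].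
- lia.
- by rewrite mul1n in E; rewrite addTb -leqNgt; lia.
- have := ltn_pmod (a * r) n0; have := ltn_pmod (a * (n - r)) n0; nia.
Qed.

End HalfSystem.

(** As x runs over the half system 1, ..., h, so does the representative of b x or - b x. By
    [jacobi_term] the sign of a b x is the product of the sign of b x and the sign of a times that
    representative. *)
Lemma jacobiM (a b n : nat) : odd n -> coprime a n -> coprime b n ->
  jacobi (a * b) n = jacobi a n (+) jacobi b n.
Proof.
move=> n_odd an bn; rewrite addbC !jacobi_addb.
pose fold x := let r := (b * x) %% n in if r <= n./2 then r else n - r.
have mem x : x \in iota 1 n./2 -> 0 < x <= n./2 by rewrite mem_iota add1n ltnS.
have P : perm_eq [seq fold x | x <- iota 1 n./2] (iota 1 n./2).
  have U : uniq [seq fold x | x <- iota 1 n./2].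
    rewrite map_inj_in_uniq ?iota_uniq // => x y /mem xh /mem yh.
    exact: fold_inj.
  have S : {subset [seq fold x | x <- iota 1 n./2] <= iota 1 n./2}.
    move=> y /mapP [x /mem xh ->]; rewrite mem_iota add1n ltnS; exact: fold_half.
  apply: uniq_perm => //; first exact: iota_uniq.
  by have [] := uniq_min_size U S; rewrite size_map.
rewrite -[X in _ = _ (+) X](perm_big _ P) big_map -big_split /=; apply: eq_big_seq => x /mem xh.
exact: jacobi_term.
Qed.

Lemma jacobi_square (x a n : nat) : odd n -> coprime a n -> x * x = a %[mod n] ->
  jacobi a n = false.
Proof.
move=> n_odd an E; rewrite -(jacobi_mod _ _ _ E).
have xn : coprime x n.
  have : coprime (x * x) n by rewrite -coprime_modl E coprime_modl.
  by rewrite coprimeMl => /andP [].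
by rewrite jacobiM // addbb.
Qed.

(** With m x = q n + r, the only multiple of n that can meet the window is (q + 1) n, at distance n
    - r; it does so exactly when r exceeds the half of n. *)
Lemma jacobi_lattice (m n x : nat) : odd m -> odd n -> coprime m n -> 0 < x <= n./2 ->
  \sum_(j < m./2) (m * x < n * j.+1 <= m * x + n./2) = (n./2 < (m * x) %% n).
Proof.
move=> m_odd n_odd mn xh.
have nE := odd_halfE n n_odd; have mE := odd_halfE m m_odd; have n0 : 0 < n by rewrite nE.
have E := divn_eq (m * x) n; set q := m * x %/ n in E *; set r := (m * x) %% n in E *.
have rn : r < n by rewrite ltn_pmod.
have r0 : 0 < r by apply: mulmod_gt0.
case: ltnP => hr.
  have qm : q < m./2 by nia.
  rewrite (bigD1 (Ordinal qm)) //= big1 ?addn0.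
    by have -> : m * x < n * q.+1 <= m * x + n./2 by apply/andP; split; nia.
  move=> j /eqP jq; have {}jq : j <> q :> nat by move=> e; apply: jq; apply: val_inj.
  by apply/eqP; rewrite eqb0; apply/negP => /andP [h1 h2]; apply: jq; nia.
rewrite big1 // => j _; apply/eqP; rewrite eqb0; apply/negP => /andP [h1 h2].
case: (leqP j.+1 q) => jq; have := leq_mul (leqnn n) jq; first by rewrite (mulnC n q); lia.
by rewrite mulnS (mulnC n q); lia.
Qed.

(* Both symbols count lattice points of a rectangle near its diagonal; the involution
   [rev_ord] exchanges the remaining points above and below. *)
Lemma jacobi_reciprocity (m n : nat) : odd m -> odd n -> coprime m n ->
  jacobi m n (+) jacobi n m = odd (m./2 * n./2).
Proof.
move=> m_odd n_odd mn; rewrite /jacobi -oddD.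
set h := n./2; set k := m./2.
have nE : n = h.*2.+1 := odd_halfE n n_odd; have mE : m = k.*2.+1 := odd_halfE m m_odd.
have -> : \sum_(i < h) (h < (m * i.+1) %% n) =
  \sum_(i < h) \sum_(j < k) (m * i.+1 < n * j.+1 <= m * i.+1 + h).
  by apply: eq_bigr => i _; rewrite jacobi_lattice //= ltn_ord.
have -> : \sum_(j < k) (k < (n * j.+1) %% m) =
  \sum_(i < h) \sum_(j < k) (n * j.+1 < m * i.+1 <= n * j.+1 + k).
  rewrite exchange_big; apply: eq_bigr => j _.
  by rewrite jacobi_lattice //= 1?coprime_sym // ltn_ord.
pose U := \sum_(i < h) \sum_(j < k) (m * i.+1 + h < n * j.+1).
have UV : U = \sum_(i < h) \sum_(j < k) (n * j.+1 + k < m * i.+1).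
  rewrite /U (reindex_inj rev_ord_inj); apply: eq_bigr => i _.
  rewrite (reindex_inj rev_ord_inj); apply: eq_bigr => j _ /=.
  have := ltn_ord i; have := ltn_ord j; move: (i : nat) (j : nat) => x y yk xh.
  congr (nat_of_bool _); rewrite !subnSK //.
  have [x' hx] : exists x', h = x + x' by exists (h - x); lia.
  have [y' hy] : exists y', k = y + y' by exists (k - y); lia.
  rewrite nE mE hx hy !addKn; apply/idP/idP; nia.
have T : k * h = \sum_(i < h) \sum_(j < k) (m * i.+1 < n * j.+1 <= m * i.+1 + h) +
    \sum_(i < h) \sum_(j < k) (n * j.+1 < m * i.+1 <= n * j.+1 + k) + (U + U).
  rewrite {2}UV /U -!big_split /=.
  transitivity (\sum_(i < h) \sum_(j < k) 1).
    by rewrite (eq_bigr (fun=> k)) => [|i _]; rewrite big_const_ord iter_addn ?mul1n addn0.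
  apply: eq_bigr => i _; rewrite -!big_split /=; apply: eq_bigr => j _.
  have XY : m * i.+1 <> n * j.+1.
    move=> E; have : n %| m * i.+1 by rewrite E dvdn_mulr.
    rewrite Gauss_dvdr 1?coprime_sym // => /dvdn_leq.
    by have := ltn_ord i; lia.
  by move: XY; set X := m * _; set Y := n * _; lia.
by rewrite T [RHS]oddD addnn odd_double addbF.
Qed.

(** This form evaluates by computation; it yields the tables modulo 5 and 47. *)
Lemma jacobi_count (a n : nat) :
  jacobi a n = odd (count (fun x => n./2 < (a * x) %% n) (iota 1 n./2)).
Proof.
rewrite jacobi_addb; elim: (iota 1 n./2) => [|x s IH]; first by rewrite big_nil.
by rewrite big_cons IH oddD oddb.
Qed.

(** * Residues modulo 5 and 47 forced by reciprocity *)

Lemma jacobi_flip (a M x : nat) : odd a -> M %% 4 = 1 -> coprime a M ->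
  x * x = a %[mod M] -> jacobi M a = false.
Proof.
move=> a_odd M4 aM xa.
have ME : M = (M %/ 4).*2.*2.+1 by rewrite {1}(divn_eq M 4) M4 addn1 -!muln2 -mulnA.
have M_odd : odd M by rewrite ME /= odd_double.
have := jacobi_reciprocity a M a_odd M_odd aM.
rewrite (jacobi_square x a M) // addFb oddM => ->.
by rewrite ME /= uphalf_double odd_double andbF.
Qed.

(** In Jacobi symbols: (a | M) = 1 because a is a square, so (M | a) = 1 because M is 1 modulo 4. As
    4 is a square and 4 M is 5 modulo a, (5 | a) = 1, and finally (a | 5) = 1. *)
Lemma square_mod_residue5 (a M q x : nat) : odd a -> M %% 4 = 1 -> 4 * M = q * a + 5 ->
  ~~ (5 %| a) -> x * x = a %[mod M] -> a %% 5 = 1 \/ a %% 5 = 4.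
Proof.
move=> a_odd M4 E a5 xa.
have co5 : coprime a 5 by rewrite coprime_sym prime_coprime.
have co2 : coprime 2 a by rewrite coprime2n.
have co4 : coprime a (4 * M) by rewrite E /coprime gcdnMDl.
have aM : coprime a M by move: co4; rewrite coprimeMr => /andP [].
have H1 := jacobi_flip a M x a_odd M4 aM xa.
have H2 : jacobi (4 * M) a = false.
  have -> : 4 * M = 2 * 2 * M by [].
  have co22 : coprime (2 * 2) a by rewrite coprimeMl co2.
  have Ma : coprime M a by rewrite coprime_sym.
  by rewrite jacobiM // H1 jacobiM // addbb.
have H3 : jacobi 5 a = false by rewrite -H2; apply: jacobi_mod; rewrite E modnMDl.
have := jacobi_reciprocity a 5 a_odd isT co5.
rewrite H3 addbF oddM andbF (jacobi_mod a (a %% 5)) ?modn_mod // => H.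
move: H; have := ltn_pmod a (isT : 0 < 5); move: a5; rewrite /dvdn.
by case: (a %% 5) => [|[|[|[|[|r]]]]] // _ _; rewrite ?jacobi_count //; [left|right].
Qed.

(** Modulo M, i is a square root of -1, so (i x)^2 is 47 and reciprocity gives (M | 47) = 1. *)
Lemma neg47_residue (M i x t : nat) : M %% 4 = 1 -> i * i + 1 = M -> x * x + 47 = t * M ->
  ~~ (47 %| M) -> jacobi (M %% 47) 47 = false.
Proof.
move=> M4 iM xM M47.
rewrite (jacobi_mod _ M) ?modn_mod //; apply: (jacobi_flip 47 M (i * x)) => //.
  by rewrite prime_coprime.
apply/eqP; rewrite -(eqn_modDr (t * M)) -{1}xM.
have -> : i * x * (i * x) + (x * x + 47) = (x * x) * M + 47 by rewrite -iM; lia.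
by rewrite modnMDl addnC modnMDl.
Qed.

Lemma square_residue5_Z (a M q x t j k l : Z) :
  (0 <= q -> 0 <= t -> 0 < M -> 0 < a -> a = 2 * k + 1 -> M = 4 * j + 1 ->
   4 * M = q * a + 5 -> x * x = a + t * M -> a = 5 * l + 2 \/ a = 5 * l + 3 -> False)%Z.
Proof.
move=> q0 t0 M0 a0 a2 M4 E xa a5.
have [a' Ea] : exists n, a = Z.of_nat n by apply: Z_of_nat_complete; lia.
have [M' EM] : exists n, M = Z.of_nat n by apply: Z_of_nat_complete; lia.
have [q' Eq] : exists n, q = Z.of_nat n by apply: Z_of_nat_complete; lia.
have [t' Et] : exists n, t = Z.of_nat n by apply: Z_of_nat_complete; lia.
have [x' Ex] : exists n, (x * x = Z.of_nat n * Z.of_nat n)%Z.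
  by exists (Z.abs_nat x); rewrite Zabs2Nat.id_abs Z.abs_square.
subst a M q t; clear q0 t0.
have d5 : ~~ (5 %| a') by lia.
have h1 : odd a' by lia.
have h2 : M' %% 4 = 1 by lia.
have h3 : 4 * M' = q' * a' + 5 by lia.
have h4 : x' * x' = t' * M' + a' by lia.
have h5 : x' * x' = a' %[mod M'] by rewrite h4 modnMDl.
have := square_mod_residue5 a' M' q' x' h1 h2 h3 d5 h5; lia.
Qed.

Definition quadratic_residue47 (m : Z) : bool :=
  List.existsb (Z.eqb m) (List.map Z.of_nat
    (1 :: 2 :: 3 :: 4 :: 6 :: 7 :: 8 :: 9 :: 12 :: 14 :: 16 :: 17 :: 18 :: 21 :: 24 :: 25 :: 27
     :: 28 :: 32 :: 34 :: 36 :: 37 :: 42 :: nil)).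

Lemma neg47_residue_Z (M i x t j l c : Z) :
  (M = 4 * j + 1 -> i * i + 1 = M -> x * x + 47 = t * M -> M = 47 * l + c -> 0 < c < 47 ->
   quadratic_residue47 c = true)%Z.
Proof.
move=> M4 iM xM M47 c47.
have M0 : (0 < M)%Z by have := Z.square_nonneg i; lia.
have t0 : (0 <= t)%Z by apply: (Zmult_le_0_reg_r M); have := Z.square_nonneg x; lia.
have [M' EM] : exists n, M = Z.of_nat n by apply: Z_of_nat_complete; lia.
have [t' Et] : exists n, t = Z.of_nat n by apply: Z_of_nat_complete; lia.
have [x' Ex] : exists n, (x * x = Z.of_nat n * Z.of_nat n)%Z.
  by exists (Z.abs_nat x); rewrite Zabs2Nat.id_abs Z.abs_square.
have [i' Ei] : exists n, (i * i = Z.of_nat n * Z.of_nat n)%Z.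
  by exists (Z.abs_nat i); rewrite Zabs2Nat.id_abs Z.abs_square.
subst M t.
have h1 : M' %% 4 = 1 by lia.
have h2 : i' * i' + 1 = M' by lia.
have h3 : x' * x' + 47 = t' * M' by lia.
have h4 : ~~ (47 %| M') by lia.
have H := neg47_residue M' i' x' t' h1 h2 h3 h4.
have -> : (c = Z.of_nat (M' %% 47))%Z by lia.
move: H; have : M' %% 47 <> 0 by lia.
have := ltn_pmod M' (isT : 0 < 47).
rewrite jacobi_count; move: (M' %% 47) => n.
by do 47 (case: n => [|n] //).
Qed.

End Jacobi.

(** * Integrality of the approximants *)

(** The recurrence of the approximants at s = 1 / 239, scaled by 956^k and cleared of denominators.
    Together with the initial values it is the only link between the integrality argument and the
    real estimates. *)
Definition pade_recurrence (X : nat -> Z) : Prop := forall k : nat,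
  let r := Z.of_nat (S k) in
  (r * (r + 1) * X (S (S k)) =
   1912 * r * (2 * r + 1) * X (S k) + 4 * (16 * r * r - 1) * X k)%Z.

Module PadeIntegers.

Import ZArith.
Import all_boot all_order all_algebra.
Import mathcomp.algebra_tactics.ring.
Import mathcomp.algebra_tactics.lra mathcomp.zify.zify mathcomp.zify.ssrZ.
Import Order.TTheory GRing.Theory Num.Theory.
Local Open Scope ring_scope.

(** * Denominators of the binomial coefficients of r + 1/4 *)

Lemma logn2_fact_le (n : nat) : (logn 2 n`! <= n)%N.
Proof.
rewrite logn_fact //.
have H K : (\sum_(1 <= k < K.+1) n %/ 2 ^ k + n %/ 2 ^ K <= n)%N.
  elim: K => [|K IH]; first by rewrite big_nil expn0 divn1.
  apply: leq_trans IH; rewrite big_nat_recr //= -addnA leq_add2l addnn -muln2.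
  by rewrite expnSr divnMA leq_divM.
by apply: leq_trans (H n); apply: leq_addr.
Qed.

(** The 2-part of k! divides 2^k by Legendre's formula. Modulo the odd part 4 is invertible, so the
    product is congruent to 4^k times a falling factorial, which k! divides. *)
Lemma quarter_binomial_dvd (r k : nat) :
  (k`!%:Z %| 2 ^+ k * \prod_(j < k) (4 * (r%:Z - j%:Z) + 1))%Z.
Proof.
set m := ((k`!)`_2^')%N; set e := ((k`!)`_2)%N.
have ke : k`! = (e * m)%N by rewrite partnC // fact_gt0.
have em : coprime e m by apply: coprime_partC.
have m_odd : odd m.
  by have := part_pnat 2%N^' k`!; rewrite p'natE // dvdn2 negbK.
rewrite ke PoszM Gauss_dvdz //; apply/andP; split.
  apply: dvdz_mulr.
  have -> : (2 : int) ^+ k = (2 ^ k)%N%:Z by rewrite -natrX natz.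
  by rewrite dvdzE /= /e p_part dvdn_exp2l // logn2_fact_le.
apply: dvdz_mull.
(* An inverse of 4 modulo m, increased by k m so that no subtraction in the falling factorial is
   truncated. *)
pose n := ((m.+1)./2 ^ 2 + k * m)%N.
have hn : (4 * n%:Z = 1 %[mod m])%Z.
  apply/eqP; rewrite eqz_mod_dvd; apply/dvdzP.
  exists (m%:Z + 2 + 4 * k%:Z).
  have : ((m.+1)./2 * 2 = m.+1)%N by rewrite muln2 halfK /= m_odd /= subn0.
  rewrite /n; set h := (m.+1)./2 => hh.
  have hh' : m%:Z = 2 * h%:Z - 1 by lia.
  rewrite PoszD -mulnn !PoszM hh'; ring.
have E : (\prod_(j < k) (4 * (r%:Z - j%:Z) + 1) =
          \prod_(j < k) (4 * ((r + n)%N%:Z - j%:Z)) %[mod m])%Z.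
  apply: (big_rec2 (fun x y => x = y %[mod m])%Z) => // i x y _ xy.
  rewrite -modzMm xy modzMm -modzMml -[RHS]modzMml; congr (_ * _ %% _)%Z.
  rewrite PoszD; have -> : 4 * (r%:Z + n%:Z - i%:Z) = 4 * (r%:Z - i%:Z) + 4 * n%:Z by ring.
  by rewrite -modzDmr -hn modzDmr.
apply/dvdz_mod0P; rewrite E; apply/dvdz_mod0P.
rewrite big_split /=; apply: dvdz_mull.
have -> : \prod_(j < k) ((r + n)%N%:Z - j%:Z) = ((r + n) ^_ k)%N%:Z.
  rewrite ffact_prod rmorph_prod; apply: eq_bigr => j _ /=.
  rewrite subzn // /n addnA (leq_trans (ltnW (ltn_ord j))) // (leq_trans _ (leq_addl _ _)) //.
  by rewrite leq_pmulr // odd_gt0.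
by rewrite -bin_ffact ke mulnA PoszM dvdz_mull.
Qed.

(* the binomial coefficient of r + 1/4 over k *)
Definition gbin (r k : nat) : rat :=
  \prod_(j < k) ((r%:R - j%:R + 4%:R^-1) / j.+1%:R).

Lemma gbin_scaled_int (r k : nat) : exists z : int, 8 ^+ k * gbin r k = z%:~R.
Proof.
have /dvdzP [z Hz] := quarter_binomial_dvd r k; exists z.
have fk : (k`!%:R : rat) != 0 by rewrite pnatr_eq0 -lt0n fact_gt0.
apply: (mulIf fk).
rewrite -[k`!%:R]/(k`!%:Z%:~R) -intrM -Hz intrM.
rewrite /gbin [in LHS]big_split /= prodfV.
have -> : (k`!%:Z%:~R : rat) = \prod_(j < k) j.+1%:R.
  by rewrite fact_prod big_add1 big_mkord -natr_prod.
rewrite mulrA mulfVK; last first.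
  by apply/prodf_neq0 => j _; rewrite pnatr_eq0.
rewrite rmorph_prod rmorphXn /=.
have -> : (8 : rat) ^+ k = 2%:~R ^+ k * \prod_(j < k) 4.
  by rewrite prodr_const card_ord -exprMn -natrM.
rewrite -mulrA -big_split /=; congr (_ * _); apply: eq_bigr => j _.
by rewrite rmorphD rmorphM rmorphB /=; field.
Qed.

Lemma gbin0 (r : nat) : gbin r 0 = 1.
Proof. by rewrite /gbin big_ord0. Qed.

Lemma gbinS (r k : nat) :
  gbin r k.+1 = gbin r k * ((r%:R - k%:R + 4%:R^-1) / k.+1%:R).
Proof. by rewrite /gbin big_ord_recr. Qed.

Lemma gbinSS (r k : nat) :
  gbin r.+1 k.+1 = (r.+1%:R + 4%:R^-1) / k.+1%:R * gbin r k.
Proof.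
elim: k => [|k IH]; first by rewrite gbinS !gbin0; field.
rewrite gbinS IH gbinS.
have k1 : (k.+1%:R : rat) != 0 by rewrite pnatr_eq0.
have k2 : (k.+2%:R : rat) != 0 by rewrite pnatr_eq0.
by move: k1 k2; rewrite -!(natr1 k.+1) -!(natr1 k) -!(natr1 r) => k1 k2; field; apply/andP.
Qed.

Definition pade_coef (r k : nat) : rat := 'C(2 * r - k, r)%:R * gbin r k.

(* With X = - x, [pade_poly r] and its analogue for r - 1/4 are the numerator and the
   denominator of the r-th diagonal Pade approximant of (1 - x)^(1/4), up to the factor
   'C(2 r, r). *)
Definition pade_poly (r : nat) : {poly rat} := \poly_(k < r.+1) pade_coef r k.

(** A positive index is essential: for index 0 the truncated subtraction makes the binomial
    ['C(0 - k, 0)] equal to 1, and [pade_coef 0 k] does not vanish beyond the degree. *)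
Lemma pade_polyS_coef (r k : nat) : (pade_poly r.+1)`_k = pade_coef r.+1 k.
Proof.
rewrite coef_poly; case: ltnP => // rk.
by rewrite /pade_coef bin_small ?mul0r //; lia.
Qed.

Lemma central_bin_half (k : nat) : 'C(2 * k.+1, k.+1) = (2 * 'C(2 * k.+1 - 1, k.+1))%N.
Proof.
have -> : (2 * k.+1 = (2 * k).+2)%N by lia.
rewrite binS subn1 /=; suff -> : 'C((2 * k).+1, k) = 'C((2 * k).+1, k.+1) by rewrite addnn -mul2n.
by rewrite -bin_sub; [congr 'C(_, _) | ]; lia.
Qed.

(** The coefficients are compared. Degrees 0 and 1 stand apart because the last term starts in
    degree 2. From there on, all binomials are rational multiples of one of them, and an identity of
    rational functions remains. *)
Lemma pade_poly_rec (r : nat) : let n : rat := r.+1%:R in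
  (n * (n + 1)) *: pade_poly r.+2 =
  (n * (2 * n + 1)) *: (2 *: pade_poly r.+1 + pade_poly r.+1 * 'X)
  - (n ^+ 2 - 16%:R^-1) *: (pade_poly r * 'X * 'X).
Proof.
move=> n; have n0 : n != 0 by rewrite pnatr_eq0.
have n1 : n + 1 != 0 by rewrite natr1 pnatr_eq0.
apply/polyP => -[|[|j]]; rewrite !(coefB, coefZ, coefD, coefMX) !pade_polyS_coef /=.
- rewrite !mulr0 subr0 addr0 /pade_coef !subn0 !gbin0 !mulr1 central_bin_half natrM.
  have -> : (2 * r.+2 - 1 = (2 * r.+1).+1)%N by lia.
  have E : (n + 1) * 'C((2 * r.+1).+1, r.+2)%:R = (2 * n + 1) * 'C(2 * r.+1, r.+1)%:R.
    by rewrite /n natr1 -!natrM natr1 -!natrM -mul_bin_diag.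
  set c := 'C(_, r.+2)%:R in E *; set b := 'C(_, _)%:R in E *.
  have -> : n * (n + 1) * (2 * c) = 2 * n * ((n + 1) * c) by ring.
  by rewrite E; ring.
- rewrite !mulr0 subr0 /pade_coef gbinSS gbinSS subn0 !gbin0 !mulr1 central_bin_half natrM.
  have -> : (2 * r.+2 - 1 = (2 * r.+1).+1)%N by lia.
  have E : (n + 1) * 'C((2 * r.+1).+1, r.+2)%:R = (2 * n + 1) * (2 * 'C(2 * r.+1 - 1, r.+1)%:R).
    rewrite -[2]/(2%:R) -[in RHS]natrM -central_bin_half.
    by rewrite /n natr1 -!natrM natr1 -!natrM -mul_bin_diag.
  rewrite -(natr1 r.+1) -/n.
  set c := 'C(_, r.+2)%:R in E *; set b := 'C(_, _)%:R in E *.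
  have -> : c = (2 * n + 1) * (2 * b) / (n + 1) by rewrite -E mulrC mulKf.
  by field; rewrite nat1r natr1 pnatr_eq0.
rewrite coef_poly; case: ltnP => jr; last first.
  rewrite /pade_coef !bin_small; try lia. by rewrite !mul0r; ring.
rewrite /pade_coef (gbinSS r.+1 j.+1) (gbinS r.+1 j.+1) !(gbinSS r j).
have [m Hm] : exists m, (r = j + m)%N by exists (r - j)%N; lia.
have -> : (2 * r.+2 - j.+2 = (r + m).+2)%N by lia.
have -> : (2 * r.+1 - j.+2 = (r + m))%N by lia.
have -> : (2 * r.+1 - j.+1 = (r + m).+1)%N by lia.
have -> : (2 * r - j = (r + m))%N by lia.
have E1 : n * 'C((r + m).+1, r.+1)%:R = (r%:R + m%:R + 1) * 'C(r + m, r)%:R.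
  by rewrite -natrD natr1 -!natrM -mul_bin_diag.
have E2 : n * 'C(r + m, r.+1)%:R = m%:R * 'C(r + m, r)%:R.
  by rewrite /n -!natrM mul_bin_left addKn.
have E3 : (n + 1) * 'C((r + m).+2, r.+2)%:R = (r%:R + m%:R + 2) * 'C((r + m).+1, r.+1)%:R.
  by rewrite /n natr1 -natrD -[2]/(2%:R) -natrD addn2 -!natrM -mul_bin_diag.
set b := 'C(r + m, r)%:R in E1 E2 *.
have {}E1 : 'C((r + m).+1, r.+1)%:R = (r%:R + m%:R + 1) * b / n by rewrite -E1 mulrC mulKf.
rewrite {}E1 in E3 *.
have {E2} -> : 'C(r + m, r.+1)%:R = m%:R * b / n by rewrite -E2 mulrC mulKf.
have -> : 'C((r + m).+2, r.+2)%:R = (r%:R + m%:R + 2) * ((r%:R + m%:R + 1) * b / n) / (n + 1).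
  by rewrite -E3 mulrC mulKf.
have j1 : (j.+1%:R : rat) != 0 by rewrite pnatr_eq0.
have j2 : (j.+2%:R : rat) != 0 by rewrite pnatr_eq0.
have Er : r%:R = j%:R + m%:R :> rat by rewrite Hm natrD.
move: j1 j2 n0 n1; rewrite -!(natr1 r.+1) -/n -!(natr1 j.+1) -!(natr1 j) /n -(natr1 r) Er.
set x := j%:R; set y := m%:R; set g := gbin r j => j1 j2 n0 n1; clearbody x y g b.
by field; rewrite j1 j2 n0 n1.
Qed.

(** * Homogenisation and the scaled approximants *)

Section Homogenisation.

Variables y z : {poly rat}.

(** This is y^r p (z / y) without division, for p of degree at most r. *)
Definition homog (r : nat) (p : {poly rat}) : {poly rat} :=
  \sum_(k < r.+1) p`_k *: (z ^+ k * y ^+ (r - k)).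

Lemma homogD (r : nat) (p q : {poly rat}) : homog r (p + q) = homog r p + homog r q.
Proof. by rewrite /homog -big_split; apply: eq_bigr => k _; rewrite coefD scalerDl. Qed.

Lemma homogZ (r : nat) (a : rat) (p : {poly rat}) : homog r (a *: p) = a *: homog r p.
Proof. by rewrite /homog scaler_sumr; apply: eq_bigr => k _; rewrite coefZ scalerA. Qed.

Lemma homogS (r : nat) (p : {poly rat}) : (size p <= r.+1)%N ->
  homog r.+1 p = y * homog r p.
Proof.
move=> sp; rewrite /homog big_ord_recr /= nth_default // scale0r addr0 mulr_sumr.
apply: eq_bigr => k _; rewrite -scalerAr; congr (_ *: _).
by rewrite subSn -1?ltnS // exprS mulrCA.
Qed.

Lemma homogMX (r : nat) (p : {poly rat}) : homog r.+1 (p * 'X) = z * homog r p.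
Proof.
rewrite /homog big_ord_recl coefMX /= scale0r add0r mulr_sumr.
apply: eq_bigr => k _; rewrite coefMX /= -scalerAr; congr (_ *: _).
by rewrite exprS mulrA subSS.
Qed.

End Homogenisation.

Lemma size_pade_poly (r : nat) : (size (pade_poly r) <= r.+1)%N.
Proof. exact: size_poly. Qed.

Lemma homog_pade_rec (y z : {poly rat}) (r : nat) :
  let n : rat := r.+1%:R in let q k := homog y z k (pade_poly k) in
  (n * (n + 1)) *: q r.+2 =
  (n * (2 * n + 1)) *: ((2 *: y + z) * q r.+1) - (n ^+ 2 - 16%:R^-1) *: (z * (z * q r)).
Proof.
move=> n q; rewrite /q -homogZ pade_poly_rec -/n -scaleNr homogD !homogZ homogD homogZ.
by rewrite !homogMX (homogS _ _ r.+1) ?size_pade_poly // scaleNr (mulrDl (2 *: y)) -scalerAl.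
Qed.

(** Once 2 y + z is a constant c, the middle coefficient of the recurrence is a rational number.
    With 'X^2 = -1 in the last term, the real and imaginary parts then satisfy the recurrence
    separately. *)
Lemma homog_pade_rec_double (y : {poly rat}) (c d : rat) (r : nat) :
  let n : rat := r.+1%:R in let q k := homog y (d *: 'X) k (pade_poly k) in
  2 *: y + d *: 'X = c%:P ->
  (n * (n + 1)) *: q r.+2 =
  (c * n * (2 * n + 1)) *: q r.+1 - ((n ^+ 2 - 16%:R^-1) * d ^+ 2) *: (q r * 'X * 'X).
Proof.
move=> n q Hy; have := homog_pade_rec y (d *: 'X) r.
rewrite Hy -/n -/(q r) -/(q r.+1) => ->.
rewrite mul_polyC -!scalerAl -!scalerAr !scalerA.
congr (_ *: _ - _ *: _); [by ring | by ring | ].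
by rewrite [RHS]mulrC [q r * _]mulrC.
Qed.

(* [pade_num r] at 'X = i is (4 (239 + i))^r Q_r, where Q_r is [pade_poly r] at - 2 i / (239 + i).
   With a formal 'X in place of i, all coefficients are rational. *)
Definition pade_num (r : nat) : {poly rat} :=
  homog (4 *: (239%:P + 'X)) (- 8 *: 'X) r (pade_poly r).

Lemma pade_num_rec (r : nat) : let n : rat := r.+1%:R in
  (n * (n + 1)) *: pade_num r.+2 =
  (1912 * n * (2 * n + 1)) *: pade_num r.+1
  - (4 * (16 * n ^+ 2 - 1)) *: (pade_num r * 'X * 'X).
Proof.
have E : 2 *: (4 *: (239%:P + 'X)) + (- 8) *: 'X = 1912%:P :> {poly rat}.
  rewrite scalerA scalerDr -addrA -scalerDl.
  have -> : 2 * 4 - 8 = 0 :> rat by lra.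
  by rewrite scale0r addr0 -mul_polyC -polyCM -!natrM.
move=> n; apply: etrans (homog_pade_rec_double _ _ _ r E) _.
by congr (_ - _ *: _); field.
Qed.

(** The factor 8^k contained in (- 8 'X)^k clears the denominator of [gbin r k]. *)
Lemma pade_num_int (S : subringClosed rat) (r j : nat) : (pade_num r)`_j \in S.
Proof.
apply/(@polyOverP _ S); rewrite /pade_num; set y := 4 *: _.
have y_int : y \is a polyOver S.
  apply: polyOverZ; first exact: rpred_nat.
  by apply: rpredD; [rewrite polyOverC rpred_nat | exact: polyOverX].
rewrite /homog rpred_sum // => k _.
have [m Hm] := gbin_scaled_int r k.
rewrite coef_poly ltn_ord exprZn -scalerAl scalerA exprNn.
have -> : pade_coef r k * ((- 1) ^+ k * 8 ^+ k) = (- 1) ^+ k * 'C(2 * r - k, r)%:R * m%:~R.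
  by rewrite -Hm /pade_coef; ring.
apply: polyOverZ; first by rewrite rpredM ?rpred_int // rpredM ?rpred_nat ?rpred_sign.
by apply: rpredM; apply: rpredX => //; exact: polyOverX.
Qed.

(** * Real and imaginary parts as integer sequences *)

Section Functional.

Variable e : nat -> rat.
Hypothesis e_anti : forall j, e j.+2 = - e j.

(** When [e j] is the real or the imaginary part of i^j, this is the corresponding part of p (i),
    obtained without leaving the rationals. *)
Definition coef_sum (p : {poly rat}) : rat := \sum_(j < size p) p`_j * e j.

Lemma coef_sumE (N : nat) (p : {poly rat}) : (size p <= N)%N ->
  coef_sum p = \sum_(j < N) p`_j * e j.
Proof.
move=> sp; rewrite /coef_sum (big_ord_widen N (fun j => p`_j * e j)) // big_mkcond.
by apply: eq_bigr => j _; case: ltnP => // pj; rewrite nth_default ?mul0r.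
Qed.

Lemma coef_sumB (a b : rat) (p q : {poly rat}) :
  coef_sum (a *: p - b *: q) = a * coef_sum p - b * coef_sum q.
Proof.
set N := maxn (size p) (size q).
have sN : (size (a *: p - b *: q)%R <= N)%N.
  apply: leq_trans (size_polyD _ _) _; rewrite size_polyN geq_max.
  by rewrite !(leq_trans (size_scale_leq _ _)) ?leq_maxl ?leq_maxr.
rewrite !(coef_sumE N) ?leq_maxl ?leq_maxr // !mulr_sumr -sumrB.
by apply: eq_bigr => j _; rewrite coefB !coefZ; ring.
Qed.

Lemma coef_sumZ (a : rat) (p : {poly rat}) : coef_sum (a *: p) = a * coef_sum p.
Proof.
rewrite (coef_sumE (size p)) ?size_scale_leq // /coef_sum mulr_sumr.
by apply: eq_bigr => j _; rewrite coefZ mulrA.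
Qed.

Lemma coef_sumMXX (p : {poly rat}) : coef_sum (p * 'X * 'X) = - coef_sum p.
Proof.
rewrite (coef_sumE (size p).+2).
  rewrite !big_ord_recl !coefMX /= !mul0r !add0r /coef_sum -sumrN.
  by apply: eq_bigr => j _; rewrite !coefMX /= e_anti mulrN.
by do ![apply: leq_trans (size_polyMleq _ _) _; rewrite size_polyX addn2 /= ltnS].
Qed.

Definition pade_int (r : nat) : int := Num.floor (coef_sum (pade_num r)).

Hypothesis e_int : forall j, e j \is a Num.int.

Lemma pade_intE (r : nat) : (pade_int r)%:~R = coef_sum (pade_num r).
Proof.
apply: floorK; apply: rpred_sum => j _; apply: rpredM => //.
exact: pade_num_int.
Qed.

Lemma pade_int_rec (r : nat) (n := r.+1%:Z) :
  n * (n + 1) * pade_int r.+2 =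
  1912 * n * (2 * n + 1) * pade_int r.+1 + 4 * (16 * n * n - 1) * pade_int r.
Proof.
apply: (@intr_inj rat); have := congr1 coef_sum (pade_num_rec r).
rewrite /= coef_sumZ coef_sumB coef_sumMXX -!pade_intE.
rewrite -[r.+1%:R]/(n%:~R) => E.
have -> : (n * (n + 1) * pade_int r.+2)%:~R = n%:~R * (n%:~R + 1) * (pade_int r.+2)%:~R :> rat.
  by ring.
by rewrite E; ring.
Qed.

Lemma pade_int0 : (pade_int 0)%:~R = e 0.
Proof.
rewrite pade_intE /pade_num /homog big_ord_recl big_ord0 coef_poly /pade_coef gbin0 /=.
by rewrite bin0 mulr1 scale1r addr0 mulr1 (coef_sumE 1) ?size_polyC ?oner_eq0 // big_ord1 coef1 mul1r.
Qed.

Lemma coef_sum_affine (a b c : rat) :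
  coef_sum (a *: (b%:P + 'X) + c *: 'X) = a * b * e 0 + (a + c) * e 1.
Proof.
rewrite (coef_sumE 2); last first.
  apply: leq_trans (size_polyD _ _) _; rewrite geq_max.
  rewrite !(leq_trans (size_scale_leq _ _)) ?size_polyX //.
  by rewrite (leq_trans (size_polyD _ _)) // size_polyX geq_max size_polyC; case: eqP.
by rewrite !big_ord_recl big_ord0 !(coefD, coefZ, coefC, coefX) /=; ring.
Qed.

Lemma pade_int1 : (pade_int 1)%:~R = 1912 * e 0 - 2 * e 1.
Proof.
have c0 : pade_coef 1 0 = 2 by rewrite /pade_coef gbin0 mulr1.
have c1 : pade_coef 1 1 = 5 / 4.
  by rewrite /pade_coef gbinS gbin0 -[(2 * 1 - 1)%N]/1%N bin1; lra.
have homog1 y z p : homog y z 1 p = p`_0 *: y + p`_1 *: z.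
  by rewrite /homog !big_ord_recl big_ord0 /= expr0 mul1r mulr1 addr0.
by rewrite pade_intE /pade_num homog1 !coef_poly c0 c1 !scalerA coef_sum_affine; lra.
Qed.

End Functional.

(* the real part of i^j, or its imaginary part if b holds *)
Definition i_part (b : bool) (j : nat) : rat := if odd j == b then (- 1) ^+ j./2 else 0.

Lemma i_part_anti (b : bool) (j : nat) : i_part b j.+2 = - i_part b j.
Proof. by rewrite /i_part /= negbK; case: eqP; rewrite ?oppr0 // exprS mulN1r. Qed.

Lemma i_part_int (b : bool) (j : nat) : i_part b j \is a Num.int.
Proof. by rewrite /i_part; case: eqP; rewrite ?rpred0 ?rpred_sign. Qed.

Lemma pade_integers_int : exists A B : nat -> int,
  [/\ A 0 = 1, A 1 = 1912, B 0 = 0, B 1 = -2 &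
   forall r (n := r.+1%:Z),
     n * (n + 1) * A r.+2 = 1912 * n * (2 * n + 1) * A r.+1 + 4 * (16 * n * n - 1) * A r /\
     n * (n + 1) * B r.+2 = 1912 * n * (2 * n + 1) * B r.+1 + 4 * (16 * n * n - 1) * B r].
Proof.
have anti := i_part_anti; have int := i_part_int.
exists (pade_int (i_part false)), (pade_int (i_part true)); split; try apply: (@intr_inj rat).
- exact: pade_int0.
- apply: etrans (pade_int1 _ (int _)) _.
  have -> : i_part false 0 = 1 by [].
  have -> : i_part false 1 = 0 by [].
  by ring.
- exact: pade_int0.
- apply: etrans (pade_int1 _ (int _)) _.
  have -> : i_part true 0 = 0 by [].
  have -> : i_part true 1 = 1 by [].
  by ring.
by move=> r n; split; apply: pade_int_rec.
Qed.

Lemma pade_recurrence_of_int (A : nat -> int) :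
  (forall r (n := r.+1%:Z),
     n * (n + 1) * A r.+2 = 1912 * n * (2 * n + 1) * A r.+1 + 4 * (16 * n * n - 1) * A r) ->
  pade_recurrence (fun r => Z_of_int (A r)).
Proof. by move=> H k; have {}H := H k; cbv beta zeta in H |- *; lia. Qed.

Lemma pade_integers : exists A B : nat -> Z,
  A 0%N = Zpos 1 /\ A 1%N = Zpos 1912 /\ B 0%N = Z0 /\ B 1%N = Zneg 2 /\
  pade_recurrence A /\ pade_recurrence B.
Proof.
have [A [B [A0 A1 B0 B1 H]]] := pade_integers_int.
exists (fun r => Z_of_int (A r)), (fun r => Z_of_int (B r)).
split; first by rewrite A0.
split; first by rewrite A1.
split; first by rewrite B0.
split; first by rewrite B1.
by split; apply: pade_recurrence_of_int => r; have [] := H r.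
Qed.

End PadeIntegers.

(** * Approximation of arctan (1 / 239) / 4 *)

Module Pade.

Import ZArith Lia Reals Lra.
Import Coquelicot.Coquelicot.
Local Open Scope R_scope.

(* The two solutions [pade_re] and [pade_im] of this recurrence are the real and imaginary part
   of (1 + i s)^n Q_n(2 i s / (1 + i s)), where Q_n is the numerator of the n-th diagonal
   Pade approximant of (1 - x)^(1/4). *)
Fixpoint pade_seq (s x0 x1 : R) (n : nat) : R * R :=
  match n with
  | O => (x0, x1)
  | S m =>
      let r := INR (S m) in
      let (x, y) := pade_seq s x0 x1 m in
      (y, 2 * (2 * r + 1) / (r + 1) * y
          + 4 * (r ^ 2 - 1 / 16) / (r * (r + 1)) * s ^ 2 * x)
  end.

Definition pade_re (n : nat) (s : R) : R := fst (pade_seq s 1 2 n).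
Definition pade_im (n : nat) (s : R) : R := fst (pade_seq s 0 (- s / 2) n).

Lemma pade_seq_rec (s x0 x1 : R) (n : nat) :
  fst (pade_seq s x0 x1 (S (S n))) =
  2 * (2 * INR (S n) + 1) / (INR (S n) + 1) * fst (pade_seq s x0 x1 (S n))
  + 4 * (INR (S n) ^ 2 - 1 / 16) / (INR (S n) * (INR (S n) + 1)) * s ^ 2
    * fst (pade_seq s x0 x1 n).
Proof.
assert (E : forall m, fst (pade_seq s x0 x1 (S m)) = snd (pade_seq s x0 x1 m)).
{ intros m; cbn [pade_seq]; destruct (pade_seq s x0 x1 m); reflexivity. }
rewrite !E; cbn [pade_seq].
destruct (pade_seq s x0 x1 n) as [x y]; cbn [fst snd]; reflexivity.
Qed.

Lemma pade_re_rec (n : nat) (s : R) :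
  pade_re (S (S n)) s =
  2 * (2 * INR (S n) + 1) / (INR (S n) + 1) * pade_re (S n) s
  + 4 * (INR (S n) ^ 2 - 1 / 16) / (INR (S n) * (INR (S n) + 1)) * s ^ 2
    * pade_re n s.
Proof. exact (pade_seq_rec s 1 2 n). Qed.

Lemma pade_im_rec (n : nat) (s : R) :
  pade_im (S (S n)) s =
  2 * (2 * INR (S n) + 1) / (INR (S n) + 1) * pade_im (S n) s
  + 4 * (INR (S n) ^ 2 - 1 / 16) / (INR (S n) * (INR (S n) + 1)) * s ^ 2
    * pade_im n s.
Proof. exact (pade_seq_rec s 0 (- s / 2) n). Qed.

(** A contiguous relation: the derivative of the approximant of index [S n] in terms of the values
    of index [S n] and [n]. *)
Definition pade_dre (n : nat) (s : R) : R :=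
  (INR (S n) * s * pade_re (S n) s + pade_im (S n) s / 4
   - 2 * (INR (S n) ^ 2 - 1 / 16) / INR (S n) * s * pade_re n s) / (1 + s ^ 2).
Definition pade_dim (n : nat) (s : R) : R :=
  (INR (S n) * s * pade_im (S n) s - pade_re (S n) s / 4
   - 2 * (INR (S n) ^ 2 - 1 / 16) / INR (S n) * s * pade_im n s) / (1 + s ^ 2).

Lemma pade_derive_step (f g df dg : R -> R) (h : R -> R) (c d s : R) :
  (forall t, h t = c * f t + d * t ^ 2 * g t) ->
  is_derive f s (df s) -> is_derive g s (dg s) ->
  is_derive h s (c * df s + d * (2 * s * g s + s ^ 2 * dg s)).
Proof.
intros H Hf Hg.
apply (is_derive_ext (fun t => c * f t + d * t ^ 2 * g t)); [now intros t; rewrite H|].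
evar_last.
- auto_derive.
  + split; [now exists (df s)|split; [now exists (dg s)|exact I]].
  + reflexivity.
- replace (Derive (fun x => f x) s) with (df s) by (symmetry; now apply is_derive_unique).
  replace (Derive (fun x => g x) s) with (dg s) by (symmetry; now apply is_derive_unique).
  ring.
Qed.

(** Differentiating the three-term recurrence needs the derivatives at two consecutive indices, so
    the induction carries both. *)
Lemma pade_derive (n : nat) :
  (forall s, is_derive (pade_re (S n)) s (pade_dre n s)) /\
  (forall s, is_derive (pade_im (S n)) s (pade_dim n s)).
Proof.
assert (P : forall m,
  ((forall s, is_derive (pade_re (S m)) s (pade_dre m s)) /\
   (forall s, is_derive (pade_im (S m)) s (pade_dim m s))) /\
  ((forall s, is_derive (pade_re (S (S m))) s (pade_dre (S m) s)) /\
   (forall s, is_derive (pade_im (S (S m))) s (pade_dim (S m) s)))).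
{ induction m as [|m [[IH1 IH2] [IH3 IH4]]].
  - assert (H1 : forall s, is_derive (pade_re 1) s (pade_dre 0 s)).
    { intros s. apply (is_derive_ext (fun _ => 2)); [reflexivity|].
      evar_last; [auto_derive; auto|].
      unfold pade_dre, pade_re, pade_im; simpl; field; nra. }
    assert (H2 : forall s, is_derive (pade_im 1) s (pade_dim 0 s)).
    { intros s. apply (is_derive_ext (fun t => - t / 2)); [reflexivity|].
      evar_last; [auto_derive; auto|].
      unfold pade_dim, pade_re, pade_im; simpl; field; nra. }
    split; [split; assumption|split]; intros s.
    + evar_last.
      * apply (pade_derive_step _ _ (pade_dre 0) (fun _ => 0) _ _ _ s (pade_re_rec 0)); auto.
        apply (is_derive_ext (fun _ => 1)); [reflexivity|]. apply @is_derive_const.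
      * unfold pade_dre, pade_re, pade_im; simpl; field; nra.
    + evar_last.
      * apply (pade_derive_step _ _ (pade_dim 0) (fun _ => 0) _ _ _ s (pade_im_rec 0)); auto.
        apply (is_derive_ext (fun _ => 0)); [reflexivity|]. apply @is_derive_const.
      * unfold pade_dim, pade_re, pade_im; simpl; field; nra.
  - split; [split; assumption|split]; intros s;
    assert (0 < INR (S m)) by (apply lt_0_INR; lia).
    + evar_last.
      * apply (pade_derive_step _ _ _ _ _ _ _ s (pade_re_rec (S m)) (IH3 s) (IH1 s)).
      * unfold pade_dre. rewrite (pade_re_rec (S m)), (pade_re_rec m), (pade_im_rec (S m)), (pade_im_rec m).
        rewrite !(S_INR (S (S m))), !(S_INR (S m)).
        generalize dependent (INR (S m)); intros; field; repeat split; nra.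
    + evar_last.
      * apply (pade_derive_step _ _ _ _ _ _ _ s (pade_im_rec (S m)) (IH4 s) (IH2 s)).
      * unfold pade_dim. rewrite (pade_re_rec (S m)), (pade_re_rec m), (pade_im_rec (S m)), (pade_im_rec m).
        rewrite !(S_INR (S (S m))), !(S_INR (S m)).
        generalize dependent (INR (S m)); intros; field; repeat split; nra. }
apply P.
Qed.

(** * Size of the approximants *)

Lemma pade_coef_bounds (r : R) : 1 <= r ->
  3 <= 2 * (2 * r + 1) / (r + 1) <= 4 /\
  0 < 4 * (r ^ 2 - 1 / 16) / (r * (r + 1)) <= 4 * (r / (r + 1)) /\ r / (r + 1) <= 1.
Proof.
intros Hr.
assert (Hr1 : 0 < r + 1) by lra. assert (Hr2 : 0 < r * (r + 1)) by nra.
assert (X : forall a b c, 0 < c -> a * c <= b -> a <= b / c).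
{ intros a b c Hc H; apply Rmult_le_reg_r with c; [lra|].
  unfold Rdiv; rewrite Rmult_assoc, Rinv_l; lra. }
assert (Y : forall a b c, 0 < c -> a <= b * c -> a / c <= b).
{ intros a b c Hc H; apply Rmult_le_reg_r with c; [lra|].
  unfold Rdiv; rewrite Rmult_assoc, Rinv_l; lra. }
repeat split.
- apply X; lra.
- apply Y; lra.
- apply Rdiv_lt_0_compat; nra.
- apply Y; [lra|]. replace (4 * (r / (r + 1)) * (r * (r + 1))) with (4 * r ^ 2) by (field; lra). nra.
- apply Y; lra.
Qed.

Lemma INR_S_ge1 (n : nat) : 1 <= INR (S n).
Proof. rewrite S_INR; pose proof (pos_INR n); lra. Qed.

Lemma pade_re_pos (n : nat) (s : R) : 0 < pade_re n s.
Proof.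
enough (0 < pade_re n s /\ 0 < pade_re (S n) s) by tauto.
induction n as [|n [H0 H1]].
- unfold pade_re; simpl; lra.
- split; [exact H1|]. rewrite pade_re_rec.
  destruct (pade_coef_bounds _ (INR_S_ge1 n)) as [[A _] [[B _] _]].
  set (al := 2 * _ / _) in *. set (be := 4 * (_ - _) / _) in *.
  assert (0 <= s ^ 2 * pade_re n s) by nra. nra.
Qed.

Lemma pade_re_growth (n : nat) (s : R) : 3 * pade_re (S n) s <= pade_re (S (S n)) s.
Proof.
rewrite pade_re_rec.
destruct (pade_coef_bounds _ (INR_S_ge1 n)) as [[A _] [[B _] _]].
set (al := 2 * _ / _) in *. set (be := 4 * (_ - _) / _) in *.
pose proof (pade_re_pos n s). pose proof (pade_re_pos (S n) s).
assert (0 <= s ^ 2 * pade_re n s) by nra. nra.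
Qed.

Lemma pade_re_lower (n : nat) (s : R) : 2 * 3 ^ n <= pade_re (S n) s.
Proof.
induction n as [|n IH].
- unfold pade_re; simpl; lra.
- pose proof (pade_re_growth n s); simpl; lra.
Qed.

Lemma pade_re_mono (n : nat) (s : R) : pade_re n s <= pade_re (S n) s.
Proof.
destruct n as [|n].
- unfold pade_re; simpl; lra.
- pose proof (pade_re_growth n s); pose proof (pade_re_pos (S n) s); lra.
Qed.

Lemma pade_re_upper (n : nat) (s : R) : pade_re n s <= (4 + 4 * s ^ 2) ^ n.
Proof.
assert (G : forall m, pade_re (S m) s <= (4 + 4 * s ^ 2) * pade_re m s).
{ intros [|m].
  - unfold pade_re; cbn; nra.
  - rewrite pade_re_rec.
    destruct (pade_coef_bounds _ (INR_S_ge1 m)) as [[A A'] [[B B'] C]].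
    set (al := 2 * _ / _) in *. set (be := 4 * (_ - _) / _) in *.
    set (ro := _ / _) in *.
    pose proof (pade_re_mono m s). pose proof (pade_re_pos m s).
    assert (be * (s ^ 2 * pade_re m s) <= 4 * (s ^ 2 * pade_re (S m) s)).
    { apply Rmult_le_compat; [lra| |lra|]; nra. }
    nra. }
induction n as [|n IH].
- unfold pade_re; simpl; lra.
- eapply Rle_trans; [apply G|]. rewrite <- tech_pow_Rmult. apply Rmult_le_compat_l; [nra|exact IH].
Qed.

Lemma pade_im_le_re (n : nat) (s : R) : 0 <= s <= 1 -> Rabs (pade_im n s) <= pade_re n s.
Proof.
intros Hs.
enough (Rabs (pade_im n s) <= pade_re n s /\ Rabs (pade_im (S n) s) <= pade_re (S n) s)
  by tauto.
induction n as [|n [H0 H1]].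
- unfold pade_im, pade_re; simpl; rewrite Rabs_R0; split; [lra|].
  apply Rabs_le; lra.
- split; [exact H1|]. rewrite pade_re_rec, pade_im_rec.
  destruct (pade_coef_bounds _ (INR_S_ge1 n)) as [[A A'] [[B B'] C]].
  set (al := 2 * _ / _) in *. set (be := 4 * (_ - _) / _) in *.
  apply Rabs_le_between in H0. apply Rabs_le_between in H1.
  assert (0 <= be * s ^ 2) by nra.
  apply Rabs_le. nra.
Qed.

(** * The determinant of consecutive approximants and the error of the argument *)

Definition pade_det (n : nat) (s : R) : R :=
  pade_re (S n) s * pade_im n s - pade_re n s * pade_im (S n) s.

Lemma pade_det_rec (n : nat) (s : R) :
  pade_det (S n) s =
  - (4 * (INR (S n) ^ 2 - 1 / 16) / (INR (S n) * (INR (S n) + 1)) * s ^ 2 * pade_det n s).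
Proof. unfold pade_det; rewrite pade_re_rec, pade_im_rec; ring. Qed.

Lemma pade_det_neq0 (n : nat) (s : R) : s <> 0 -> pade_det n s <> 0.
Proof.
intros Hs; induction n as [|n IH].
- unfold pade_det, pade_re, pade_im; simpl; lra.
- rewrite pade_det_rec.
  destruct (pade_coef_bounds _ (INR_S_ge1 n)) as [_ [[B _] _]].
  set (be := 4 * (_ - _) / _) in *.
  apply Ropp_neq_0_compat, Rmult_integral_contrapositive_currified; [|exact IH].
  apply Rmult_integral_contrapositive_currified; [lra|]. now apply pow_nonzero.
Qed.

(** The coefficient in [pade_det_rec] is at most 4 r / (r + 1) s^2, and the factors r / (r + 1)
    telescope. The weight gained cancels the factor of size 2 r in the derivative of [pade_arg]. *)
Lemma pade_det_bound (n : nat) (s : R) : 0 <= s ->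
  INR (S n) * Rabs (pade_det n s) <= s / 2 * (4 * s ^ 2) ^ n.
Proof.
intros Hs; induction n as [|n IH].
- unfold pade_det, pade_re, pade_im; simpl.
  replace (2 * 0 - 1 * (- s / 2)) with (s / 2) by lra. rewrite Rabs_pos_eq; lra.
- rewrite pade_det_rec.
  destruct (pade_coef_bounds _ (INR_S_ge1 n)) as [_ [[B B'] _]].
  rewrite (S_INR (S n)). set (r := INR (S n)) in *.
  assert (Hr : 1 <= r) by apply INR_S_ge1.
  set (be := 4 * (_ - _) / _) in *.
  rewrite Rabs_Ropp, Rabs_mult, (Rabs_pos_eq (be * s ^ 2)) by nra.
  pose proof (Rabs_pos (pade_det n s)).
  assert ((r + 1) * be <= 4 * r).
  { replace (4 * r) with ((r + 1) * (4 * (r / (r + 1)))) by (field; lra).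
    apply Rmult_le_compat_l; lra. }
  assert (P : 0 <= s ^ 2 * Rabs (pade_det n s)) by nra.
  rewrite <- (tech_pow_Rmult (4 * s ^ 2)).
  apply Rle_trans with (4 * s ^ 2 * (r * Rabs (pade_det n s))).
  + replace ((r + 1) * (be * s ^ 2 * Rabs (pade_det n s)))
      with ((r + 1) * be * (s ^ 2 * Rabs (pade_det n s))) by ring.
    replace (4 * s ^ 2 * (r * Rabs (pade_det n s)))
      with (4 * r * (s ^ 2 * Rabs (pade_det n s))) by ring.
    now apply Rmult_le_compat_r.
  + replace (s / 2 * (4 * s ^ 2 * (4 * s ^ 2) ^ n))
      with (4 * s ^ 2 * (s / 2 * (4 * s ^ 2) ^ n)) by ring.
    apply Rmult_le_compat_l; [nra|exact IH].
Qed.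

(* The argument of (1 + i s)^(1/4) times the n-th approximant; its derivative is a constant times
   s^(2 n) / ((1 + s^2) |approximant|^2) because [pade_det] is a monomial in s. *)
Definition pade_arg (n : nat) (s : R) : R :=
  atan (pade_im n s / pade_re n s) + atan s / 4.

Lemma pade_arg_bound (n : nat) (s : R) : 0 <= s <= 1 ->
  Rabs (pade_arg (S n) s) <= s ^ 3 / 4 * (4 * s ^ 2 / 9) ^ n.
Proof.
intros Hs.
set (r := INR (S n)).
assert (Hr : 1 <= r) by apply INR_S_ge1.
set (dg := fun t => - (2 * (r ^ 2 - 1 / 16) / r * t * pade_det n t) /
   ((pade_re (S n) t ^ 2 + pade_im (S n) t ^ 2) * (1 + t ^ 2))).
assert (Hd : forall t : R, is_derive (pade_arg (S n)) t (dg t)).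
{ intros t. destruct (pade_derive n) as [Da Db].
  pose proof (pade_re_pos (S n) t) as Pa.
  unfold pade_arg. evar_last.
  - auto_derive.
    + split; [eexists; apply Db|split; [eexists; apply Da|split; [lra|exact I]]].
    + reflexivity.
  - replace (Derive (fun x => pade_re (S n) x) t) with (pade_dre n t)
      by (symmetry; apply is_derive_unique, Da).
    replace (Derive (fun x => pade_im (S n) x) t) with (pade_dim n t)
      by (symmetry; apply is_derive_unique, Db).
    (* The terms with 1/4 in the two derivatives cancel against the derivative of [atan s / 4]; only
       the determinant survives. *)
    unfold dg, pade_det, pade_dre, pade_dim. fold r.
    field. repeat split; nra. }
assert (B : forall t, 0 <= t <= s -> Rabs (dg t) <= s ^ 2 / 4 * (4 * s ^ 2 / 9) ^ n).
{ intros t Ht. unfold dg.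
  pose proof (pade_det_bound n t (proj1 Ht)) as W. fold r in W.
  pose proof (pade_re_lower n t) as L.
  assert (P3 : 0 < 3 ^ n) by (apply pow_lt; lra).
  assert (Den : 4 * 9 ^ n <= (pade_re (S n) t ^ 2 + pade_im (S n) t ^ 2) * (1 + t ^ 2)).
  { replace 9 with (3 * 3) by lra. rewrite Rpow_mult_distr.
    assert (4 * (3 ^ n * 3 ^ n) <= pade_re (S n) t ^ 2) by nra.
    assert (0 <= pade_im (S n) t ^ 2) by nra. assert (0 <= t ^ 2) by nra. nra. }
  assert (P9 : 0 < 9 ^ n) by (apply pow_lt; lra).
  unfold Rdiv at 1. rewrite Rabs_mult, Rabs_Ropp, Rabs_inv.
  rewrite (Rabs_pos_eq (_ * (1 + _))) by lra.
  assert (Num : Rabs (2 * (r ^ 2 - 1 / 16) / r * t * pade_det n t) <= s ^ 2 * (4 * s ^ 2) ^ n).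
  { assert (K : 0 <= 2 * (r ^ 2 - 1 / 16) / r <= 2 * r).
    { split; [apply Rle_mult_inv_pos; nra|].
      apply Rmult_le_reg_r with r; [lra|]. unfold Rdiv; rewrite Rmult_assoc, Rinv_l; nra. }
    set (k := 2 * _ / r) in *.
    rewrite Rabs_mult, (Rabs_pos_eq (k * t)) by nra.
    pose proof (Rabs_pos (pade_det n t)) as Pd.
    apply Rle_trans with (2 * t * (r * Rabs (pade_det n t))).
    - assert (0 <= t * Rabs (pade_det n t)) by nra. nra.
    - apply Rle_trans with (2 * t * (t / 2 * (4 * t ^ 2) ^ n)).
      + apply Rmult_le_compat_l; lra.
      + replace (2 * t * (t / 2 * (4 * t ^ 2) ^ n)) with (t ^ 2 * (4 * t ^ 2) ^ n) by field.
        apply Rmult_le_compat; [nra|apply pow_le; nra|nra|].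
        apply pow_incr; nra. }
  apply Rle_trans with (s ^ 2 * (4 * s ^ 2) ^ n * / (4 * 9 ^ n)).
  - apply Rmult_le_compat; [apply Rabs_pos| |exact Num|apply Rinv_le_contravar; lra].
    apply Rlt_le, Rinv_0_lt_compat; lra.
  - apply Req_le. unfold Rdiv at 2. rewrite (Rpow_mult_distr _ (/ 9)), pow_inv. field. lra. }
assert (Z0 : pade_arg (S n) 0 = 0).
{ unfold pade_arg.
  assert (I : pade_im (S n) 0 = 0).
  { enough (pade_im n 0 = 0 /\ pade_im (S n) 0 = 0) by tauto.
    clear. induction n as [|n [H0 H1]].
    - unfold pade_im; simpl; lra.
    - split; [exact H1|]. rewrite pade_im_rec, H1, H0; ring. }
  rewrite I. unfold Rdiv; rewrite Rmult_0_l, atan_0; ring. }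
destruct (MVT_gen (pade_arg (S n)) 0 s dg) as [t [Ht E]].
- intros t _; apply Hd.
- intros t _. apply continuity_pt_filterlim. apply (ex_derive_continuous (pade_arg (S n))). eexists; apply Hd.
- rewrite Z0 in E. rewrite Rmin_left, Rmax_right in Ht by lra.
  replace (pade_arg (S n) s) with (dg t * s) by lra.
  rewrite Rabs_mult, (Rabs_pos_eq s) by lra.
  replace (s ^ 3 / 4 * (4 * s ^ 2 / 9) ^ n) with (s ^ 2 / 4 * (4 * s ^ 2 / 9) ^ n * s) by field.
  apply Rmult_le_compat_r; [lra|]. apply B; lra.
Qed.

(** The left side is the imaginary part of the approximant rotated by atan s / 4, hence its modulus
    times the sine of [pade_arg]. The modulus is [pade_re] over the cosine of an angle of tangent at
    most 1 in absolute value; that cosine is at least 1/2. *)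
Lemma pade_linear_form (n : nat) (s : R) : 0 <= s <= 1 ->
  Rabs (pade_re n s * sin (atan s / 4) + pade_im n s * cos (atan s / 4))
  <= 2 * pade_re n s * Rabs (pade_arg n s).
Proof.
intros Hs. pose proof (pade_re_pos n s) as Pa.
pose proof (pade_im_le_re n s Hs) as Hb.
set (a := pade_re n s) in *. set (b := pade_im n s) in *.
assert (Hx : Rabs (b / a) <= 1).
{ unfold Rdiv. rewrite Rabs_mult, Rabs_inv, (Rabs_pos_eq a) by lra.
  apply Rmult_le_reg_r with a; [lra|]. rewrite Rmult_assoc, Rinv_l; lra. }
set (be := atan (b / a)). set (ph := atan s / 4).
assert (Cb : 0 < cos be) by (pose proof (atan_bound (b / a)) as h; fold be in h; apply cos_gt_0; lra).
assert (Ec : cos be = 1 / sqrt (1 + (b / a) ^ 2)).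
{ unfold be. rewrite cos_atan. now unfold Rsqr, pow; rewrite Rmult_1_r. }
assert (Hc : 1 <= 2 * cos be).
{ apply Rabs_le_between in Hx.
  assert (sqrt (1 + (b / a) ^ 2) <= 2).
  { rewrite <- (sqrt_square 2) by lra. apply sqrt_le_1_alt. nra. }
  assert (0 < sqrt (1 + (b / a) ^ 2)) by (apply sqrt_lt_R0; nra).
  rewrite Ec. apply Rmult_le_reg_r with (sqrt (1 + (b / a) ^ 2)); [lra|].
  field_simplify; lra. }
assert (Sb : b * cos be = a * sin be).
{ assert (T : tan be = b / a) by apply tan_atan.
  unfold tan in T. apply (Rmult_eq_reg_r (/ a * / cos be)).
  - replace (a * sin be * (/ a * / cos be)) with (sin be / cos be) by (field; lra).
    rewrite T. field; lra.
  - apply Rmult_integral_contrapositive_currified; apply Rinv_neq_0_compat; lra. }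
assert (E : (a * sin ph + b * cos ph) * cos be = a * sin (pade_arg n s)).
{ unfold pade_arg. fold a b be ph. rewrite sin_plus.
  transitivity (a * sin ph * cos be + b * cos be * cos ph); [ring|]. rewrite Sb; ring. }
assert (Hsin : forall x, Rabs (sin x) <= Rabs x).
{ intros x. destruct (Rle_dec 0 x) as [h|h].
  - rewrite (Rabs_pos_eq x) by lra. apply Rabs_le.
    destruct (Req_dec x 0) as [->|]; [rewrite sin_0; lra|].
    destruct (Rle_dec x 1) as [h1|h1].
    + assert (sin x < x) by (apply sin_lt_x; lra).
      assert (0 < sin x) by (pose proof PI2_1; apply sin_gt_0; lra). lra.
    + pose proof (SIN_bound x); lra.
  - rewrite (Rabs_left x) by lra. apply Rabs_le.
    assert (S' : sin x = - sin (- x)) by (rewrite sin_neg; lra).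
    destruct (Rle_dec (- x) 1) as [h1|h1].
    + assert (sin (- x) < - x) by (apply sin_lt_x; lra).
      assert (0 < sin (- x)) by (pose proof PI2_1; apply sin_gt_0; lra). lra.
    + pose proof (SIN_bound x); lra. }
specialize (Hsin (pade_arg n s)).
assert (E' : Rabs (a * sin ph + b * cos ph) * cos be = a * Rabs (sin (pade_arg n s))).
{ rewrite <- (Rabs_pos_eq (cos be)) by lra. rewrite <- Rabs_mult, E, Rabs_mult.
  rewrite (Rabs_pos_eq a); lra. }
pose proof (Rabs_pos (a * sin ph + b * cos ph)).
assert (a * Rabs (sin (pade_arg n s)) <= a * Rabs (pade_arg n s))
  by (apply Rmult_le_compat_l; lra).
nra.
Qed.

(** * The gap principle for rational approximations of [pade_angle] *)

Lemma geometric_bracket (K c x : R) (n0 : nat) : 1 < K -> 0 < c -> c * K ^ n0 <= x ->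
  exists n, (n0 <= n)%nat /\ c * K ^ n <= x < c * K ^ (S n).
Proof.
intros HK Hc H0.
assert (X : exists n, x < c * K ^ n).
{ destruct (Pow_x_infinity K) with (b := x / c + 1) as [N HN].
  - rewrite Rabs_pos_eq; lra.
  - exists N. specialize (HN N (Nat.le_refl _)).
    assert (0 < K ^ N) by (apply pow_lt; lra).
    rewrite Rabs_pos_eq in HN by lra.
    apply Rlt_le_trans with (c * (x / c + 1)).
    + replace (c * (x / c + 1)) with (x + c) by (field; lra). lra.
    + apply Rmult_le_compat_l; lra. }
destruct X as [N HN]. induction N as [|N IH].
- exfalso. simpl in HN. assert (1 <= K ^ n0) by (apply pow_R1_Rle; lra). nra.
- destruct (Rlt_dec x (c * K ^ N)) as [h|h]; [now apply IH|].
  exists N. split; [|lra].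
  destruct (le_lt_dec n0 N) as [l|l]; [exact l|exfalso].
  assert (K ^ S N <= K ^ n0) by (apply Rle_pow; [lra|lia]). nra.
Qed.

Definition pade_angle : R := atan (1 / 239) / 4.

Lemma scaled_pade_seq (x0 x1 : R) (X : nat -> Z) :
  IZR (X 0%nat) = x0 -> IZR (X 1%nat) = 956 * x1 ->
  pade_recurrence X ->
  forall k, IZR (X k) = 956 ^ k * fst (pade_seq (1 / 239) x0 x1 k).
Proof.
intros H0 H1 rec k.
enough (IZR (X k) = 956 ^ k * fst (pade_seq (1 / 239) x0 x1 k) /\
        IZR (X (S k)) = 956 ^ (S k) * fst (pade_seq (1 / 239) x0 x1 (S k))) by tauto.
induction k as [|k [IH0 IH1]].
- simpl; lra.
- split; [exact IH1|]. rewrite pade_seq_rec.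
  specialize (rec k). cbv zeta in rec. apply (f_equal IZR) in rec.
  rewrite !plus_IZR, !mult_IZR, !minus_IZR, !plus_IZR, !mult_IZR, <- INR_IZR_INZ in rec.
  rewrite IH0, IH1 in rec. pose proof (INR_S_ge1 k) as Hr.
  set (r := INR (S k)) in *.
  apply Rmult_eq_reg_l with (r * (r + 1)); [|nra].
  rewrite rec. simpl pow. field. lra.
Qed.

(** Here m + n i is (c + d i) exp (- i [pade_angle]). The integer c B k + d A k equals 956^k (m D k
    + n M k), where D is tiny by [pade_linear_form] and n by hypothesis. For two consecutive indices
    it is below 1 in absolute value, hence zero. *)
Lemma pade_approximation_gap (c d : Z) :
  let m := IZR c * cos pade_angle + IZR d * sin pade_angle in
  let n := IZR d * cos pade_angle - IZR c * sin pade_angle in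
  2 * 10 ^ 8 <= m -> Rabs n * m ^ 3 <= 160 -> False.
Proof.
intros m n Hm Hn.
destruct PadeIntegers.pade_integers as [A [B [A0 [A1 [B0 [B1 [recA recB]]]]]]].
set (s := 1 / 239).
assert (Hs : 0 <= s <= 1) by (unfold s; lra).
assert (EA : forall k, IZR (A k) = 956 ^ k * pade_re k s).
{ intros k; unfold pade_re. apply scaled_pade_seq; [now rewrite A0|rewrite A1; lra|exact recA]. }
assert (EB : forall k, IZR (B k) = 956 ^ k * pade_im k s).
{ intros k; unfold pade_im.
  apply scaled_pade_seq; [now rewrite B0|rewrite B1; unfold s; lra|exact recB]. }
set (C := cos pade_angle). set (S' := sin pade_angle).
set (D := fun k => pade_re k s * S' + pade_im k s * C).
set (M := fun k => pade_re k s * C - pade_im k s * S').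
assert (CS : C * C + S' * S' = 1).
{ pose proof (sin2_cos2 pade_angle) as h. unfold Rsqr in h. fold C S' in h. lra. }
assert (Edet : forall k, IZR (c * B k + d * A k) = 956 ^ k * (m * D k + n * M k)).
{ intros k. rewrite plus_IZR, !mult_IZR, EA, EB. unfold m, n, D, M. fold C S'.
  transitivity (956 ^ k * ((C * C + S' * S') * (IZR c * pade_im k s + IZR d * pade_re k s))).
  - rewrite CS; ring.
  - ring. }
(* The constant is 956 (4 + 4 s^2) at s = 1 / 239, rounded up. Below, 3 / 100 similarly bounds 3825
   times 4 s^2 / 9. *)
assert (Up : forall k, 956 ^ k * pade_re k s <= 3825 ^ k).
{ intros k. pose proof (pade_re_upper k s).
  apply Rle_trans with (956 ^ k * (4 + 4 * s ^ 2) ^ k).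
  - apply Rmult_le_compat_l; [apply pow_le; lra|assumption].
  - rewrite <- Rpow_mult_distr. apply pow_incr. unfold s; lra. }
assert (BM : forall k, 956 ^ k * Rabs (M k) <= 2 * 3825 ^ k).
{ intros k. pose proof (pade_im_le_re k s Hs). specialize (Up k).
  assert (Rabs (M k) <= 2 * pade_re k s).
  { unfold M. pose proof (COS_bound pade_angle) as h1. pose proof (SIN_bound pade_angle) as h2.
    fold C in h1. fold S' in h2. pose proof (pade_re_pos k s).
    apply Rabs_le_between in H. apply Rabs_le. nra. }
  assert (0 < 956 ^ k) by (apply pow_lt; lra). nra. }
assert (BD : forall k, 956 ^ S k * Rabs (D (S k)) <= 2 / 10 ^ 4 * (3 / 100) ^ k).
{ intros k. assert (h1 : Rabs (D (S k)) <= 2 * pade_re (S k) s * Rabs (pade_arg (S k) s))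
    by exact (pade_linear_form (S k) s Hs).
  pose proof (pade_arg_bound k s Hs) as h2. pose proof (pade_re_pos (S k) s) as Pa.
  set (g := Rabs (pade_arg (S k) s)) in *.
  assert (P9 : 0 < 956 ^ S k) by (apply pow_lt; lra).
  assert (Pp : 0 < 956 ^ S k * pade_re (S k) s) by (apply Rmult_lt_0_compat; assumption).
  apply Rle_trans with (2 * (956 ^ S k * pade_re (S k) s) * g).
  { replace (2 * (956 ^ S k * pade_re (S k) s) * g)
      with (956 ^ S k * (2 * pade_re (S k) s * g)) by ring.
    apply Rmult_le_compat_l; lra. }
  apply Rle_trans with (2 * (3825 ^ S k) * (s ^ 3 / 4 * (4 * s ^ 2 / 9) ^ k)).
  - specialize (Up (S k)). apply Rmult_le_compat; [lra|apply Rabs_pos| |exact h2].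
    apply Rmult_le_compat_l; lra.
  - simpl pow at 1. replace (2 * (3825 * 3825 ^ k) * (s ^ 3 / 4 * (4 * s ^ 2 / 9) ^ k))
      with ((2 * 3825 * s ^ 3 / 4) * (3825 ^ k * (4 * s ^ 2 / 9) ^ k)) by field.
    rewrite <- Rpow_mult_distr. apply Rmult_le_compat.
    + unfold s; lra.
    + apply pow_le; unfold s; lra.
    + unfold s; lra.
    + apply pow_incr; unfold s; lra. }
assert (m3 : 640 * 3825 ^ 6 <= m ^ 3).
{ apply Rle_trans with ((2 * 10 ^ 8) ^ 3); [lra|]. apply pow_incr; lra. }
(* The last N with 640 * 3825^N <= m^3 balances both terms. Up to index N the term with n is at most
   160 * 2 / 640 = 1/2. The start value 6 gives k >= 4, from where the excess of (100 / 3)^3 over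
   3825 outweighs the constants in the other term. *)
destruct (geometric_bracket 3825 640 (m ^ 3) 6) as [N [HN [L U]]]; [lra|lra|exact m3|].
destruct N as [|[|k]]; [lia|lia|].
assert (Hk : (4 <= k)%nat) by lia.
assert (Small : m * (2 / 10 ^ 4 * (3 / 100) ^ k) < 1 / 2).
{ assert (Cube : m ^ 3 < (2500 * (100 / 3) ^ k) ^ 3).
  { apply Rlt_le_trans with (1 := U). 
    rewrite Rpow_mult_distr. rewrite <- pow_mult, (Nat.mul_comm k 3), pow_mult.
    simpl (3825 ^ S (S (S k))).
    replace k with (4 + (k - 4))%nat by lia. rewrite !pow_add.
    assert (3825 ^ (k - 4) <= ((100 / 3) ^ 3) ^ (k - 4)) by (apply pow_incr; lra).
    assert (0 < 3825 ^ (k - 4)) by (apply pow_lt; lra).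
    set (u := 3825 ^ (k - 4)) in *. set (v := ((100 / 3) ^ 3) ^ (k - 4)) in *.
    lra. }
  assert (P : 0 < (100 / 3) ^ k) by (apply pow_lt; lra).
  assert (m < 2500 * (100 / 3) ^ k).
  { apply Rnot_le_lt; intros h. apply (Rlt_irrefl (m ^ 3)).
    apply Rlt_le_trans with (1 := Cube). apply pow_incr; lra. }
  replace ((3 / 100) ^ k) with (/ (100 / 3) ^ k).
  - apply Rmult_lt_reg_r with ((100 / 3) ^ k); [lra|]. field_simplify; lra.
  - rewrite <- pow_inv. f_equal. lra. }
assert (Zero : forall j, (k <= j <= S k)%nat -> (c * B (S j) + d * A (S j) = 0)%Z).
{ intros j Hj. apply Z.abs_0_iff. cut (Z.abs (c * B (S j) + d * A (S j)) < 1)%Z; [lia|].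
  apply lt_IZR. rewrite abs_IZR, Edet, Rabs_mult, (Rabs_pos_eq (956 ^ S j))
    by (apply pow_le; lra).
  apply Rle_lt_trans with (956 ^ S j * (m * Rabs (D (S j)) + Rabs n * Rabs (M (S j)))).
  { apply Rmult_le_compat_l; [apply pow_le; lra|].
    eapply Rle_trans; [apply Rabs_triang|]. rewrite !Rabs_mult, (Rabs_pos_eq m); lra. }
  specialize (BD j). specialize (BM (S j)).
  assert (T1 : m * (956 ^ S j * Rabs (D (S j))) < 1 / 2).
  { apply Rle_lt_trans with (2 := Small). apply Rmult_le_compat_l; [lra|].
    apply Rle_trans with (1 := BD). apply Rmult_le_compat_l; [lra|].
    assert (Hp : forall i, 0 <= (3 / 100) ^ i) by (intros i; apply pow_le; lra).
    replace j with (k + (j - k))%nat by lia. rewrite pow_add.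
    assert (h : (j - k = 0 \/ j - k = 1)%nat) by lia.
    specialize (Hp k). destruct h as [-> | ->]; simpl; lra. }
  assert (T2 : Rabs n * (956 ^ S j * Rabs (M (S j))) <= 1 / 2).
  { apply Rmult_le_reg_r with (m ^ 3); [apply pow_lt; lra|].
    assert (3825 ^ S j <= 3825 ^ S (S k)) by (apply Rle_pow; [lra|lia]).
    pose proof (Rabs_pos n).
    apply Rle_trans with (Rabs n * m ^ 3 * (2 * 3825 ^ S (S k))).
    - replace (Rabs n * (956 ^ S j * Rabs (M (S j))) * m ^ 3)
        with (Rabs n * m ^ 3 * (956 ^ S j * Rabs (M (S j)))) by ring.
      apply Rmult_le_compat_l; [|lra].
      apply Rmult_le_pos; [assumption|apply pow_le; lra].
    - assert (0 < 3825 ^ S (S k)) by (apply pow_lt; lra). nra. }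
  nra. }
(* The two vanishing integers form a homogeneous linear system in c and d whose determinant
   [pade_det] is not zero. *)
pose proof (Zero k ltac:(lia)) as Z0. pose proof (Zero (S k) ltac:(lia)) as Z1.
apply (f_equal IZR) in Z0. apply (f_equal IZR) in Z1.
rewrite plus_IZR, !mult_IZR, EA, EB in Z0, Z1.
assert (P1 : 0 < 956 ^ S k) by (apply pow_lt; lra).
assert (P2 : 0 < 956 ^ S (S k)) by (apply pow_lt; lra).
assert (Y0 : IZR c * pade_im (S k) s + IZR d * pade_re (S k) s = 0) by nra.
assert (Y1 : IZR c * pade_im (S (S k)) s + IZR d * pade_re (S (S k)) s = 0) by nra.
assert (W : pade_det (S k) s <> 0) by (apply pade_det_neq0; unfold s; lra).
assert (Hc : IZR c * pade_det (S k) s = 0).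
{ transitivity (pade_re (S (S k)) s * (IZR c * pade_im (S k) s + IZR d * pade_re (S k) s)
    - pade_re (S k) s * (IZR c * pade_im (S (S k)) s + IZR d * pade_re (S (S k)) s));
    [unfold pade_det; ring|rewrite Y0, Y1; ring]. }
assert (Hd : IZR d * pade_det (S k) s = 0).
{ transitivity (pade_im (S k) s * (IZR c * pade_im (S (S k)) s + IZR d * pade_re (S (S k)) s)
    - pade_im (S (S k)) s * (IZR c * pade_im (S k) s + IZR d * pade_re (S k) s));
    [unfold pade_det; ring|rewrite Y0, Y1; ring]. }
assert (c0 : IZR c = 0) by (apply Rmult_integral in Hc; tauto).
assert (d0 : IZR d = 0) by (apply Rmult_integral in Hd; tauto).
unfold m in Hm. rewrite c0, d0 in Hm. lra.
Qed.

(** The imaginary part of (239 - i) (c + d i)^4. *)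
Definition machin_form (c d : Z) : Z :=
  (239 * (4 * c * d * (c * c - d * d)) - (c * c * c * c - 6 * (c * c) * (d * d) + d * d * d * d))%Z.

(** The argument of 239 - i is - 4 [pade_angle], so (239 - i) (c + d i)^4 is |239 - i| (m + n i)^4,
    and 239 <= |239 - i|. *)
Lemma machin_form_rotated (c d : Z) :
  let m := IZR c * cos pade_angle + IZR d * sin pade_angle in
  let n := IZR d * cos pade_angle - IZR c * sin pade_angle in
  239 * Rabs (4 * (m * n * (m ^ 2 - n ^ 2))) <= Rabs (IZR (machin_form c d)).
Proof.
intros m n.
set (s := 1 / 239). set (C := cos pade_angle) in *. set (S' := sin pade_angle) in *.
assert (E2c : cos (2 * pade_angle) = C * C - S' * S') by apply cos_2a.
assert (E2s : sin (2 * pade_angle) = 2 * S' * C) by apply sin_2a.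
assert (E4 : 2 * (2 * pade_angle) = atan s) by (unfold pade_angle, s; field).
assert (E4c : cos (atan s) = (C * C - S' * S') * (C * C - S' * S') - 2 * S' * C * (2 * S' * C)).
{ rewrite <- E4, cos_2a, E2c, E2s; reflexivity. }
assert (E4s : sin (atan s) = 2 * (2 * S' * C) * (C * C - S' * S')).
{ rewrite <- E4, sin_2a, E2c, E2s; reflexivity. }
assert (Cp : 0 < cos (atan s)) by (pose proof (atan_bound s); apply cos_gt_0; lra).
assert (Ts : sin (atan s) = s * cos (atan s)).
{ pose proof (tan_atan s) as T. unfold tan in T.
  rewrite <- T at 2. field. lra. }
assert (Id : 239 * (4 * (m * n * (m ^ 2 - n ^ 2))) = IZR (machin_form c d) * cos (atan s)).
{ unfold machin_form. rewrite !minus_IZR, !plus_IZR, !mult_IZR, !minus_IZR, !mult_IZR.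
  set (x := IZR c) in *. set (y := IZR d) in *.
  transitivity (239 * (4 * x * y * (x * x - y * y)) * cos (atan s)
    - 239 * (x * x * x * x - 6 * (x * x) * (y * y) + y * y * y * y) * sin (atan s)).
  - rewrite E4c, E4s. unfold m, n. ring.
  - rewrite Ts. unfold s. field. }
rewrite <- (Rabs_pos_eq 239) at 1 by lra. rewrite <- Rabs_mult, Id, Rabs_mult.
pose proof (COS_bound (atan s)). rewrite (Rabs_pos_eq (cos _)) by lra.
pose proof (Rabs_pos (IZR (machin_form c d))). nra.
Qed.

(** The factor 4 in the bound leaves room for rotations by pi / 4: multiplying c + d i by 1 + i or 1
    - i scales the form by -4. *)
Lemma machin_form_near_axis (c d : Z) :
  let m := IZR c * cos pade_angle + IZR d * sin pade_angle in
  let n := IZR d * cos pade_angle - IZR c * sin pade_angle in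
  (Z.abs (machin_form c d) <= 4 * 13 ^ 4)%Z -> (10 ^ 17 <= c * c + d * d)%Z ->
  n ^ 2 <= m ^ 2 / 4 -> False.
Proof.
intros m n HG Hcd Hnm.
change (4 * 13 ^ 4)%Z with 114244%Z in HG. change (10 ^ 17)%Z with 100000000000000000%Z in Hcd.
assert (Hmn : m ^ 2 + n ^ 2 = IZR (c * c + d * d)).
{ pose proof (sin2_cos2 pade_angle) as h. unfold Rsqr in h.
  rewrite plus_IZR, !mult_IZR. unfold m, n.
  transitivity ((IZR c * IZR c + IZR d * IZR d) *
    (sin pade_angle * sin pade_angle + cos pade_angle * cos pade_angle)); [ring|rewrite h; ring]. }
apply IZR_le in Hcd. rewrite <- Hmn in Hcd.
pose proof (machin_form_rotated c d) as H. cbv zeta in H. fold m n in H.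
apply IZR_le in HG. rewrite abs_IZR in HG.
(* Since m^2 - n^2 is at least 3/4 m^2, the bound is 4 * 13^4 / (239 * 3), which is below 160. *)
assert (H1 : Rabs n * Rabs m ^ 3 <= 160).
{ assert (H2 : 239 * Rabs (4 * (m * n * (m ^ 2 - n ^ 2))) <= 4 * 13 ^ 4) by lra.
  rewrite !Rabs_mult, (Rabs_pos_eq (m ^ 2 - n ^ 2)), (Rabs_pos_eq 4) in H2 by nra.
  assert (Em : Rabs m ^ 2 = m ^ 2) by apply pow2_abs.
  pose proof (Rabs_pos m). pose proof (Rabs_pos n).
  assert (0 <= Rabs m * Rabs n) by (apply Rmult_le_pos; assumption).
  assert (Rabs m * Rabs n * (m ^ 2 * (3 / 4)) <= Rabs m * Rabs n * (m ^ 2 - n ^ 2))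
    by (apply Rmult_le_compat_l; lra).
  replace (Rabs n * Rabs m ^ 3) with (Rabs m * Rabs n * (Rabs m ^ 2)) by ring.
  rewrite Em. lra. }
assert (H2 : 2 * 10 ^ 8 <= Rabs m).
{ apply Rnot_lt_le; intros h. pose proof (Rabs_pos m).
  assert (Rabs m ^ 2 = m ^ 2) by apply pow2_abs. nra. }
destruct (Rle_dec 0 m) as [h|h].
- rewrite (Rabs_pos_eq m) in H1, H2 by lra.
  exact (pade_approximation_gap c d H2 H1).
- rewrite (Rabs_left m) in H1, H2 by lra.
  apply (pade_approximation_gap (- c) (- d)); rewrite !opp_IZR.
  + replace (_ + _) with (- m) by (unfold m; ring). exact H2.
  + replace (- IZR c * cos pade_angle + - IZR d * sin pade_angle) with (- m) by (unfold m; ring).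
    replace (- IZR d * cos pade_angle - - IZR c * sin pade_angle) with (- n) by (unfold n; ring).
    rewrite Rabs_Ropp. exact H1.
Qed.

(* Multiplying c + d i by the units and by 1 + i or 1 - i rotates it by multiples of
   pi / 4; some rotation brings it close to the ray of argument [pade_angle]. *)
Lemma machin_form_bound (c d : Z) :
  (Z.abs (machin_form c d) <= 13 ^ 4)%Z -> (c * c + d * d < 10 ^ 17)%Z.
Proof.
intros HG. apply Z.nle_gt; intros Hcd.
set (m := IZR c * cos pade_angle + IZR d * sin pade_angle).
set (n := IZR d * cos pade_angle - IZR c * sin pade_angle).
destruct (Rle_dec (n ^ 2) (m ^ 2 / 4)) as [h1|h1].
{ apply (machin_form_near_axis c d); [lia|exact Hcd|exact h1]. }
destruct (Rle_dec (m ^ 2) (n ^ 2 / 4)) as [h2|h2].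
{ apply (machin_form_near_axis d (- c)).
  - replace (machin_form d (- c)) with (machin_form c d) by (unfold machin_form; ring). lia.
  - lia.
  - rewrite opp_IZR.
    replace ((_ - _) ^ 2) with ((- m) ^ 2) by (unfold m; ring).
    replace ((_ + _) ^ 2) with ((n) ^ 2) by (unfold n; ring). lra. }
destruct (Rle_dec 0 (m * n)) as [h|h].
- apply (machin_form_near_axis (c + d) (d - c)).
  + replace (machin_form (c + d) (d - c)) with (- 4 * machin_form c d)%Z
      by (unfold machin_form; ring). lia.
  + lia.
  + rewrite plus_IZR, minus_IZR.
    replace ((_ - _) ^ 2) with ((n - m) ^ 2) by (unfold m, n; ring).
    replace ((_ + _) ^ 2) with ((m + n) ^ 2) by (unfold m, n; ring). nra.
- apply (machin_form_near_axis (c - d) (c + d)).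
  + replace (machin_form (c - d) (c + d)) with (- 4 * machin_form c d)%Z
      by (unfold machin_form; ring). lia.
  + lia.
  + rewrite plus_IZR, minus_IZR.
    replace ((_ + _) ^ 2) with ((m - n) ^ 2) by (unfold m, n; ring).
    replace ((_ - _) ^ 2) with ((m + n) ^ 2) by (unfold m, n; ring). nra.
Qed.

End Pade.

(** * The equations over the integers *)

Module Equations.

Import ZArith Znumtheory Lia List ListNotations.
Local Open Scope Z_scope.

(** * Coprime factors of squares and Pythagorean triples *)

Lemma square_eq_cases (x y : Z) : x * x = y * y -> x = y \/ x = - y.
Proof. nia. Qed.

(** The root is [Z.gcd a c]: by Bezout relations its square and a divide each other. *)
Lemma coprime_mul_square (a b c : Z) :
  rel_prime a b -> 0 <= a -> a * b = c * c -> exists x, 0 <= x /\ a = x * x.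
Proof.
intros Hab Ha E.
exists (Z.gcd a c). split; [apply Z.gcd_nonneg|].
apply Z.divide_antisym_nonneg; [exact Ha|pose proof (Z.gcd_nonneg a c); nia| |].
- destruct (Zis_gcd_bezout _ _ _ (Zgcd_is_gcd a c)) as [s t Hst].
  exists (s * s * a + 2 * s * t * c + t * t * b).
  rewrite <- Hst. transitivity (s * s * (a * a) + 2 * s * t * a * c + t * t * (c * c)); [ring|].
  rewrite <- E; ring.
- destruct (rel_prime_bezout _ _ Hab) as [u v Huv].
  destruct (Z.gcd_divide_l a c) as [k Hk]. destruct (Z.gcd_divide_r a c) as [l Hl].
  set (g := Z.gcd a c) in *.
  exists (u * k * k + v * l * l).
  transitivity (u * (a * a) + v * (c * c)).
  + rewrite <- E. transitivity (a * (u * a + v * b)); [rewrite Huv; ring|ring].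
  + rewrite Hk at 1 2. rewrite Hl. ring.
Qed.

Lemma bezout_coprime (a b u v : Z) : u * a + v * b = 1 -> rel_prime a b.
Proof. intros H; apply bezout_rel_prime; now exists u v. Qed.

Lemma coprime_intro (a b : Z) : (forall g, (g | a) -> (g | b) -> (g | 1)) -> rel_prime a b.
Proof. intros H; constructor; [apply Z.divide_1_l|apply Z.divide_1_l|exact H]. Qed.

Lemma coprime_elim (a b g : Z) : rel_prime a b -> (g | a) -> (g | b) -> (g | 1).
Proof. intros [_ _ H]; exact (H g). Qed.

(** Writing the even leg as 2 y and letting n be negative covers all signs of the legs. *)
Lemma pythagorean_triple (x y z : Z) :
  rel_prime x (2 * y) -> x * x + 2 * y * (2 * y) = z * z ->
  exists m n, x = m * m - n * n /\ y = m * n /\ Z.abs z = m * m + n * n /\ rel_prime m n.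
Proof.
intros Hxy E.
assert (Hx : exists k, x = 2 * k + 1).
{ destruct (Z.Even_or_Odd x) as [[k Hk]|[k Hk]]; [exfalso|now exists k].
  assert (h : (2 | 1)) by (apply (coprime_elim _ _ _ Hxy); [exists k; lia|exists y; lia]).
  destruct h as [j Hj]; lia. }
destruct Hx as [k Hk].
set (w := Z.abs z). assert (Ew : w * w = z * z) by (unfold w; nia).
assert (Hw : 0 <= w) by (unfold w; lia). clearbody w.
assert (Hwo : exists l, w = 2 * l + 1).
{ destruct (Z.Even_or_Odd w) as [[l Hl]|[l Hl]]; [exfalso; subst x w|now exists l].
  assert (4 * (k * k + k + y * y - l * l) + 1 = 0) by nia. lia. }
destruct Hwo as [l Hl].
set (P := l + k + 1). set (Q := l - k).
assert (EPQ : P * Q = y * y) by (unfold P, Q; nia).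
assert (Exd : x = P - Q) by (unfold P, Q; lia).
assert (Ewd : w = P + Q) by (unfold P, Q; lia).
clearbody P Q.
assert (HP : 0 <= P /\ 0 <= Q).
{ clear - EPQ Ewd Hw. assert (0 <= P * Q) by nia. nia. } destruct HP as [HP HQ].
assert (HPQ : rel_prime P Q).
{ apply coprime_intro; intros g gP gQ.
  apply (coprime_elim _ _ _ (rel_prime_mult _ _ _ Hxy Hxy)).
  - rewrite Exd; now apply Z.divide_sub_r.
  - replace (2 * y * (2 * y)) with (P * (4 * Q)) by lia. now apply Z.divide_mul_l. }
destruct (coprime_mul_square P Q y HPQ HP EPQ) as [m [Hm Em]].
destruct (coprime_mul_square Q P y (rel_prime_sym _ _ HPQ) HQ) as [n [Hn En]]; [lia|].
assert (Hmn : rel_prime m n).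
{ apply coprime_intro; intros g gm gn. apply (coprime_elim _ _ _ HPQ).
  - rewrite Em; now apply Z.divide_mul_l.
  - rewrite En; now apply Z.divide_mul_l. }
destruct (square_eq_cases y (m * n)) as [h|h]; [rewrite <- EPQ, Em, En; ring| |].
- exists m, n. repeat split; try lia; apply Hmn.
- exists m, (- n). split; [lia|]. split; [lia|]. split; [lia|].
  apply coprime_intro; intros g gm gn. apply (coprime_elim _ _ _ Hmn gm).
  now apply Z.divide_opp_r.
Qed.

Lemma coprime_consecutive (x : Z) : rel_prime x (x + 1).
Proof. apply (bezout_coprime _ _ (-1) 1); ring. Qed.

(** * Fermat's descent *)

Lemma congruent_number_one (m n s : Z) :
  0 < n < m -> rel_prime m n -> Z.Odd (m + n) ->
  m * n * ((m + n) * (m - n)) = s * s -> False.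
Proof.
intros Hmn; revert n s Hmn.
assert (Hm : 0 <= m \/ m < 0) by lia. destruct Hm as [Hm|Hm]; [|lia].
revert m Hm. apply (Zlt_0_ind (fun m => forall n s, 0 < n < m -> rel_prime m n ->
  Z.Odd (m + n) -> m * n * ((m + n) * (m - n)) = s * s -> False)).
intros m IH Hm n s Hmn Hco Hodd E.
assert (Codd : forall g, (g | m + n) -> (g | 2) -> (g | 1)).
{ intros g g1 g2. destruct Hodd as [k Hk].
  replace 1 with (m + n - 2 * k) by lia. apply Z.divide_sub_r; [exact g1|].
  now apply Z.divide_mul_l. }
assert (C1 : rel_prime (m * n) ((m + n) * (m - n))).
{ apply rel_prime_mult; apply rel_prime_sym; apply rel_prime_mult; apply coprime_intro;
  intros g g1 g2; apply (coprime_elim _ _ _ Hco); trivial.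
  - replace n with (m + n - m) by lia. now apply Z.divide_sub_r.
  - replace m with (m + n - n) by lia. now apply Z.divide_sub_r.
  - replace n with (m - (m - n)) by lia. now apply Z.divide_sub_r.
  - replace m with (m - n + n) by lia. now apply Z.divide_add_r. }
assert (C2 : rel_prime (m + n) (m - n)).
{ apply coprime_intro; intros g g1 g2.
  assert (h2m : (g | m * 2)).
  { replace (m * 2) with (m + n + (m - n)) by ring. now apply Z.divide_add_r. }
  assert (h2n : (g | n * 2)).
  { replace (n * 2) with (m + n - (m - n)) by ring. now apply Z.divide_sub_r. }
  assert (gm2 : rel_prime g 2) by (apply coprime_intro; intros j j1 j2; apply Codd; trivial;
    now apply Z.divide_trans with g).
  apply (coprime_elim _ _ _ Hco).
  - apply (Gauss g 2 m); [now rewrite Z.mul_comm|exact gm2].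
  - apply (Gauss g 2 n); [now rewrite Z.mul_comm|exact gm2]. }
destruct (coprime_mul_square _ _ _ C1 ltac:(nia) E) as [e [_ Ee]].
destruct (coprime_mul_square _ _ s (rel_prime_sym _ _ C1) ltac:(nia)) as [f [_ Ef]]; [lia|].
destruct (coprime_mul_square _ _ _ Hco ltac:(lia) Ee) as [r [Hr Er]].
destruct (coprime_mul_square _ _ e (rel_prime_sym _ _ Hco) ltac:(lia)) as [q [Hq Eq]]; [lia|].
destruct (coprime_mul_square _ _ _ C2 ltac:(lia) Ef) as [t [Ht Et]].
destruct (coprime_mul_square _ _ f (rel_prime_sym _ _ C2) ltac:(lia)) as [v [Hv Ev]]; [lia|].
assert (Ot : exists i, t = 2 * i + 1).
{ destruct (Z.Even_or_Odd t) as [[i Hi]|Oi]; [exfalso|exact Oi].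
  destruct Hodd as [k Hk]. subst t. lia. }
assert (Ov : exists j, v = 2 * j + 1).
{ destruct (Z.Even_or_Odd v) as [[i Hi]|Oi]; [exfalso|exact Oi].
  destruct Hodd as [k Hk]. subst v. lia. }
destruct Ot as [i Hi]. destruct Ov as [j Hj].
(* Half the sum and half the difference of the odd numbers t and v: the legs of a right triangle
   with hypotenuse r and area (q / 2)^2. *)
set (a := i + j + 1). set (b := i - j).
assert (Hab : a * a + b * b = r * r) by (unfold a, b; nia).
assert (Hab2 : 2 * (a * b) = q * q) by (unfold a, b; nia).
assert (Hvt : v < t) by (clear - Et Ev Ht Hv Hmn; nia).
assert (Hpos : 0 < b < a) by (unfold a, b; lia).
assert (Cab : rel_prime a b).
{ apply coprime_intro; intros g g1 g2. apply (coprime_elim _ _ _ C2).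
  - rewrite Et. replace t with (a + b) by (unfold a, b; lia).
    apply Z.divide_mul_l. now apply Z.divide_add_r.
  - rewrite Ev. replace v with (a - b) by (unfold a, b; lia).
    apply Z.divide_mul_l. now apply Z.divide_sub_r. }
clearbody a b.
assert (Oab : Z.Odd (a + b)).
{ destruct (Z.Even_or_Odd (a + b)) as [[k Hk]|O]; [exfalso|exact O].
  assert (Hqe : exists q', q = 2 * q').
  { destruct (Z.Even_or_Odd q) as [?|[q' Hq']]; [assumption|exfalso; subst q; lia]. }
  destruct Hqe as [q' ->].
  destruct (Z.Even_or_Odd a) as [[a' Ha]|[a' Ha]].
  - assert (h : (2 | 1)).
    { apply (coprime_elim _ _ _ Cab); [exists a'; lia|exists (k - a'); lia]. }
    destruct h as [? ?]; lia.
  - assert (b = 2 * (k - a' - 1) + 1) by lia. subst a b.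
    assert (2 * ((2 * a' + 1) * (2 * (k - a' - 1) + 1)) = 4 * (q' * q')) by lia. lia. }
(* Here x and 2 y are a and b in the order that puts the even leg last. Parametrising the triangle
   gives a pair M, N with M^2 + N^2 = r, which is smaller because m = r^2. *)
assert (Step : forall x y, x * x + 2 * y * (2 * y) = r * r -> rel_prime x (2 * y) ->
  0 < x -> 0 < y -> 4 * (x * y) = q * q -> False).
{ intros x y Exy Cxy Hx Hy Eq2.
  destruct (pythagorean_triple x y r Cxy Exy) as [m' [n' [E1 [E2 [E3 E4]]]]].
  assert (Hqe : exists q', q = 2 * q').
  { destruct (Z.Even_or_Odd q) as [?|[q' Hq']]; [assumption|exfalso; subst q; lia]. }
  destruct Hqe as [q' ->].
  assert (Habs : Z.abs m' * Z.abs n' = y) by (rewrite <- Z.abs_mul; lia).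
  assert (EM : Z.abs m' * Z.abs m' = m' * m') by apply Z.abs_square.
  assert (EN : Z.abs n' * Z.abs n' = n' * n') by apply Z.abs_square.
  assert (Cabs : rel_prime (Z.abs m') (Z.abs n')).
  { apply coprime_intro; intros g g1 g2.
    apply (coprime_elim _ _ _ E4); now apply Z.divide_abs_r. }
  assert (HM : 0 <= Z.abs m') by lia. assert (HN : 0 <= Z.abs n') by lia.
  set (M := Z.abs m') in *. set (N := Z.abs n') in *. clearbody M N.
  rewrite <- EM, <- EN in E1, E3. rewrite (Z.abs_eq r Hr) in E3.
  assert (Hn0 : 0 < N < M) by (clear - E1 Habs Hx Hy HM HN; nia).
  apply (IH M) with (n := N) (s := q').
  - split; [lia|]. clear - Er E3 Hn0. nia.
  - exact Hn0.
  - exact Cabs.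
  - destruct (Z.Even_or_Odd (M + N)) as [[k Hk]|O]; [exfalso|exact O].
    assert (h : (2 | 1)).
    { apply (coprime_elim _ _ _ Cxy).
      - exists (k * (M - N)). rewrite E1.
        transitivity ((M + N) * (M - N)); [ring|rewrite Hk; ring].
      - exists y; lia. }
    destruct h as [? ?]; lia.
  - rewrite Habs. replace ((M + N) * (M - N)) with x by (rewrite E1; ring). lia. }
destruct (Z.Even_or_Odd b) as [[b' Hb]|[b' Hb]].
- subst b. apply (Step a b'); [lia|exact Cab|lia|lia|lia].
- assert (Ha : exists a', a = 2 * a').
  { destruct Oab as [k Hk]. exists (k - b'); lia. }
  destruct Ha as [a' ->].
  apply (Step b a'); [lia|now apply rel_prime_sym|lia|lia|lia].
Qed.

(** Take m and n to be half the sum and half the difference of y^2 and x^2. Then m^2 - n^2 = (x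
    y)^2, and 4 m n = y^4 - x^4 = ((x^4 - 1) / 2)^2, so the descent applies. *)
Lemma biquadrate_plus_one (x y : Z) : x * x * (x * x) + 1 = 2 * (y * y) -> x * x = 1.
Proof.
intros E.
assert (Hx : exists k, x = 2 * k + 1).
{ destruct (Z.Even_or_Odd x) as [[k Hk]|?]; [exfalso; subst x; lia|assumption]. }
destruct Hx as [k Hk].
assert (Hy : exists l, y = 2 * l + 1).
{ destruct (Z.Even_or_Odd y) as [[l Hl]|?]; [exfalso; subst x y|assumption].
  assert (8 * (2*k*k*k*k+4*k*k*k+3*k*k+k - l * l) + 2 = 0) by nia. lia. }
destruct Hy as [l Hl].
destruct (Z.eq_dec (x * x) 1) as [|Hne]; [assumption|exfalso].
assert (Hlt : x * x < y * y) by nia.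
set (m := 2 * l * l + 2 * l + 2 * k * k + 2 * k + 1).
set (n := 2 * l * l + 2 * l - 2 * k * k - 2 * k).
assert (Em : m + n = y * y) by (unfold m, n; subst y; ring).
assert (En : m - n = x * x) by (unfold m, n; subst x; ring).
clearbody m n.
assert (Cxy : rel_prime (x * x) (y * y)).
{ apply (bezout_coprime _ _ (- (x * x)) 2). lia. }
apply (congruent_number_one m n (x * y * (2*k*k*k*k+4*k*k*k+3*k*k+k)*2)).
- assert (0 < x * x) by nia. lia.
- apply coprime_intro; intros g g1 g2. apply (coprime_elim _ _ _ Cxy).
  + rewrite <- En. now apply Z.divide_sub_r.
  + rewrite <- Em. now apply Z.divide_add_r.
- rewrite Em, Hl. exists (2 * l * l + 2 * l). ring.
- rewrite Em, En.
  set (e := 2*k*k*k*k+4*k*k*k+3*k*k+k) in *.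
  assert (Ee : x * x * (x * x) = 8 * e + 1) by (unfold e; subst x; ring).
  assert (Emn : 4 * (m * n) = (y * y) * (y * y) - (x * x) * (x * x)) by (rewrite <- Em, <- En; ring).
  assert (Ey : y * y = 4 * e + 1) by lia.
  assert (Emn' : m * n = 4 * e * e) by (rewrite Ey, Ee in Emn; lia).
  rewrite Emn'. ring.
Qed.

(** * Pell numbers: the coordinates of (1 + sqrt 2)^n *)

Fixpoint pell (n : nat) : Z * Z :=
  match n with
  | O => (1, 0)
  | S k => let (a, b) := pell k in (a + 2 * b, a + b)
  end.
Definition pellA (n : nat) : Z := fst (pell n).
Definition pellB (n : nat) : Z := snd (pell n).

Lemma pellA_S (n : nat) : pellA (S n) = pellA n + 2 * pellB n.
Proof. unfold pellA, pellB; simpl; destruct (pell n); reflexivity. Qed.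
Lemma pellB_S (n : nat) : pellB (S n) = pellA n + pellB n.
Proof. unfold pellA, pellB; simpl; destruct (pell n); reflexivity. Qed.

Lemma pell_pos (n : nat) : 1 <= pellA n /\ 0 <= pellB n.
Proof.
induction n as [|n IH]; [unfold pellA, pellB; simpl; lia|].
rewrite pellA_S, pellB_S; lia.
Qed.

(** Descent by division by 1 + sqrt 2: (x + t sqrt 2) (sqrt 2 - 1) = (2 t - x) + (x - t) sqrt 2. *)
Lemma pell_solutions (x t : Z) : 0 <= x -> 0 <= t -> Z.abs (x * x - 2 * (t * t)) = 1 ->
  exists n, x = pellA n /\ t = pellB n.
Proof.
intros Hx Ht; revert x Hx. revert t Ht.
apply (Zlt_0_ind (fun t => forall x, 0 <= x -> Z.abs (x * x - 2 * (t * t)) = 1 ->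
  exists n, x = pellA n /\ t = pellB n)).
intros t IH Ht x Hx E.
destruct (Z.eq_dec t 0) as [->|Ht0].
{ exists 0%nat. unfold pellA, pellB; simpl. nia. }
assert (H1 : t <= x < 2 * t) by nia.
destruct (IH (x - t)) with (x := 2 * t - x) as [n [E1 E2]]; [lia|lia| |].
- replace ((2 * t - x) * (2 * t - x) - 2 * ((x - t) * (x - t)))
    with (- (x * x - 2 * (t * t))) by ring. lia.
- exists (S n). rewrite pellA_S, pellB_S. lia.
Qed.

Lemma pellB_mono (m n : nat) : (m <= n)%nat -> pellB m <= pellB n.
Proof.
induction 1 as [|n _ IH]; [lia|]. rewrite pellB_S. pose proof (pell_pos n); lia.
Qed.

(** * Ljunggren's equation *)

Lemma small_square_pell (n : nat) (s : Z) :
  pellB n = s * s -> pellB n < 10 ^ 34 -> In (pellB n) [0; 1; 169].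
Proof.
intros E L.
assert (Hn : (n < 100)%nat).
{ destruct (Nat.lt_ge_cases n 100) as [h|h]; [exact h|exfalso].
  apply pellB_mono in h. assert (10 ^ 34 < pellB 100) by (vm_compute; reflexivity). lia. }
assert (Sq : Z.sqrt (pellB n) * Z.sqrt (pellB n) = pellB n).
{ assert (h : Z.sqrt (pellB n) = Z.abs s).
  { rewrite E, <- Z.abs_square. apply Z.sqrt_square. lia. }
  rewrite h, Z.abs_square. now rewrite E. }
assert (Check : forallb (fun k => implb (Z.sqrt (pellB k) * Z.sqrt (pellB k) =? pellB k)
    (existsb (Z.eqb (pellB k)) [0; 1; 169])) (List.seq 0 100) = true)
  by (vm_compute; reflexivity).
rewrite forallb_forall in Check. specialize (Check n).
rewrite (proj2 (Z.eqb_eq _ _) Sq) in Check.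
specialize (Check ltac:(apply in_seq; lia)). cbn [implb] in Check.
apply existsb_exists in Check. destruct Check as [y [Hy e]].
apply Z.eqb_eq in e. now rewrite e.
Qed.

(** The quartic is Im ((1 + i) (a + b i)^4). In terms of Z = (3 - 2 i) (a + b i) it becomes - Im
    ((239 - i) Z^4) / 13^4, and |Z|^2 = 13 (a^2 + b^2). *)
Lemma thue_equation_bound (a b : Z) :
  Z.abs (a * a * a * a + 4 * (a * a * a * b) - 6 * (a * a * b * b) - 4 * (a * b * b * b)
    + b * b * b * b) = 1 -> a * a + b * b < 10 ^ 16.
Proof.
intros H.
assert (L : (3 * a + 2 * b) * (3 * a + 2 * b) + (3 * b - 2 * a) * (3 * b - 2 * a) < 10 ^ 17).
{ apply (Pade.machin_form_bound).
  replace (Pade.machin_form (3 * a + 2 * b) (3 * b - 2 * a)) with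
    (- (28561 * (a * a * a * a + 4 * (a * a * a * b) - 6 * (a * a * b * b)
      - 4 * (a * b * b * b) + b * b * b * b))) by (unfold Pade.machin_form; ring).
  rewrite Z.abs_opp, Z.abs_mul, H. vm_compute; discriminate. }
replace ((3 * a + 2 * b) * (3 * a + 2 * b) + (3 * b - 2 * a) * (3 * b - 2 * a))
  with (13 * (a * a + b * b)) in L by ring. lia.
Qed.

Lemma square_sum_param (m n y : Z) : m * m + n * n = y * y -> rel_prime m n ->
  Z.abs (2 * (m * n) - (m * m - n * n)) = 1 ->
  exists a b, Z.abs y = a * a + b * b /\
   Z.abs (a * a * a * a + 4 * (a * a * a * b) - 6 * (a * a * b * b) - 4 * (a * b * b * b)
    + b * b * b * b) = 1.
Proof.
intros E C H.
destruct (Z.Even_or_Odd n) as [[n' ->]|[n' Hn]].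
- destruct (pythagorean_triple m n' y C E) as [a [b [E1 [E2 [E3 _]]]]].
  exists a, (- b). split; [rewrite E3; ring|]. rewrite <- H. subst m n'.
  rewrite <- Z.abs_opp. f_equal. ring.
- assert (Em : exists m', m = 2 * m').
  { destruct (Z.Even_or_Odd m) as [h|[m' Hm]]; [exact h|exfalso]. subst m n.
    assert (exists j, 2 * ((2 * m' + 1) * (2 * n' + 1)) - ((2 * m' + 1) * (2 * m' + 1)
     - (2 * n' + 1) * (2 * n' + 1)) = 2 * j) as [j Hj].
    { exists ((2 * m' + 1) * (2 * n' + 1) - (2 * m' * m' + 2 * m' - 2 * n' * n' - 2 * n')). ring. }
    rewrite Hj in H. lia. }
  destruct Em as [m' ->].
  destruct (pythagorean_triple n m' y) as [a [b [E1 [E2 [E3 _]]]]].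
  + now apply rel_prime_sym.
  + lia.
  + exists a, b. split; [exact E3|]. rewrite <- H. rewrite E1, E2. f_equal. ring.
Qed.

(** With x = 2 k + 1, the numbers k and k + 1 are the legs of a right triangle with hypotenuse y^2;
    that they differ by 1 becomes the right side of the Thue equation. Moreover x^2 - 2 (y^2)^2 =
    -1, so y^2 is a Pell number. *)
Lemma ljunggren (x y : Z) : x * x + 1 = 2 * (y * y * (y * y)) -> y * y = 1 \/ y * y = 169.
Proof.
intros E.
assert (Hx : exists k, x = 2 * k + 1).
{ destruct (Z.Even_or_Odd x) as [[k Hk]|?]; [exfalso; subst x; lia|assumption]. }
destruct Hx as [k Hk].
assert (Ek : k * k + (k + 1) * (k + 1) = y * y * (y * y)) by (subst x; lia).
pose proof (coprime_consecutive k) as C.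
assert (HAbs : Z.abs (y * y) = y * y) by nia.
assert (Hmn : exists m n, m * m + n * n = y * y /\ rel_prime m n /\
  Z.abs (2 * (m * n) - (m * m - n * n)) = 1).
{ destruct (Z.Even_or_Odd k) as [[j Hj]|[j Hj]].
  - subst k. destruct (pythagorean_triple (2 * j + 1) j (y * y)) as [m [n [E1 [E2 [E3 E4]]]]].
    + now apply rel_prime_sym.
    + lia.
    + exists m, n. split; [lia|]. split; [exact E4|]. lia.
  - destruct (pythagorean_triple k (j + 1) (y * y)) as [m [n [E1 [E2 [E3 E4]]]]].
    + now replace (2 * (j + 1)) with (k + 1) by lia.
    + replace (2 * (j + 1)) with (k + 1) by lia. exact Ek.
    + exists m, n. split; [lia|]. split; [exact E4|]. lia. }
destruct Hmn as [m [n [E1 [E2 E3]]]].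
destruct (square_sum_param m n y E1 E2 E3) as [a [b [E4 E5]]].
apply thue_equation_bound in E5. rewrite <- E4 in E5.
destruct (pell_solutions (Z.abs x) (y * y)) as [N [_ HN]]; [lia|nia| |].
- rewrite Z.abs_square. lia.
- assert (Hin := small_square_pell N y (eq_sym HN)).
  rewrite <- HN in Hin. assert (y * y < 10 ^ 34) by (rewrite <- Z.abs_square; nia).
  specialize (Hin ltac:(assumption)).
  destruct Hin as [h|[h|[h|[]]]]; [exfalso|lia|lia].
  rewrite <- h in E. lia.
Qed.

(** * The quartic of norm 2 *)

Lemma between_squares (t a c : Z) : 0 <= a -> t * t = c -> a * a < c < (a + 1) * (a + 1) -> False.
Proof.
intros Ha E H. assert (h1 : a < Z.abs t) by nia. assert (h2 : Z.abs t < a + 1) by nia. lia.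
Qed.

(** With m = 2 mu and companion form 2 nu, nu^2 = mu^2 (2 mu^2 - 1), so nu = mu v and v^2 + 1 = 2
    mu^2 unless mu = 0. This is Ljunggren's equation once mu is a square up to sign. *)
Lemma quartic_double (r q : Z) :
  let m := r * r + 2 * (r * q) - q * q in
  m * m = 2 * (r * r + q * q) ->
  In (r, q) [(0,0); (1,1); (1,-1); (-1,1); (-1,-1); (221,-91); (-221,91); (91,221); (-91,-221)].
Proof.
intros m E.
assert (Hpar : exists s, r + q = 2 * s).
{ destruct (Z.Even_or_Odd (r + q)) as [h|[k Hk]]; [exact h|exfalso].
  assert (r = 2 * k + 1 - q) by lia. 
  assert (Hm : m = 2 * (2 * k * k + 2 * k - q * q) + 1) by (unfold m; subst r; ring).
  rewrite Hm in E. lia. }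
destruct Hpar as [s Hs].
assert (Hm : exists mu, m = 2 * mu).
{ destruct (Z.Even_or_Odd m) as [h|[k Hk]]; [exact h|exfalso]. rewrite Hk in E. lia. }
destruct Hm as [mu Hmu].
assert (HH : r * r + q * q = 2 * (mu * mu)) by (rewrite Hmu in E; lia).
destruct (Z.eq_dec mu 0) as [->|Hmu0].
{ assert (r = 0 /\ q = 0) as [-> ->] by nia. simpl; tauto. }
assert (Hnu : exists nu, r * r - 2 * (r * q) - q * q = 2 * nu).
{ exists (mu - 2 * (r * q)). unfold m in Hmu. lia. }
destruct Hnu as [nu Hnu].
assert (Enu : (2 * (mu * mu) - 1) * (mu * mu) = nu * nu).
{ assert (h : m * m + (2 * nu) * (2 * nu) = 2 * ((r * r + q * q) * (r * r + q * q)))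
    by (unfold m; rewrite <- Hnu; ring).
  rewrite HH, Hmu in h. lia. }
assert (C1 : rel_prime (2 * (mu * mu) - 1) (mu * mu)).
{ apply (bezout_coprime _ _ (-1) 2). ring. }
assert (Hmu2 : 0 < mu * mu) by (clear - Hmu0; nia).
destruct (coprime_mul_square _ _ _ C1 ltac:(lia) Enu) as [x [Hx Ex]].
assert (Hsgn : exists v, nu = mu * v /\ v * v + 1 = 2 * (mu * mu)).
{ destruct (square_eq_cases nu (mu * x)) as [h|h].
  - rewrite <- Enu, Ex. ring.
  - exists x; split; [exact h|lia].
  - exists (- x); split; lia. }
destruct Hsgn as [v [Hv Ev]].
(* This uses 2 r q = mu - nu. As mu is odd and r + q even, the second factor is 4 e, and mu e is the
   square of (r + q) / 2. *)
assert (Sum : (r + q) * (r + q) = mu * (2 * mu + 1 - v)).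
{ replace (mu * (2 * mu + 1 - v)) with (2 * (mu * mu) + mu - nu) by (rewrite Hv; ring).
  rewrite <- HH. unfold m in Hmu. lia. }
assert (Om : exists j, mu = 2 * j + 1).
{ destruct (Z.Even_or_Odd mu) as [[j Hj]|h]; [exfalso|exact h].
  destruct (Z.Even_or_Odd v) as [[i Hi]|[i Hi]]; subst mu v; lia. }
destruct Om as [j Hj].
assert (He : exists e, 2 * mu + 1 - v = 4 * e).
{ assert (h : (4 | 2 * mu + 1 - v)).
  { apply (Gauss 4 mu).
    - exists (s * s). rewrite <- Sum, Hs. ring.
    - apply (bezout_coprime _ _ (- (j * j + j)) mu). subst mu; ring. }
  destruct h as [e He]. exists e. lia. }
destruct He as [e He].
assert (Ese : mu * e = s * s) by (rewrite He, Hs in Sum; lia).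
(* Substituting v = 2 mu + 1 - 4 e in v^2 + 1 = 2 mu^2 and halving gives mu (mu + 2 - 8 e) + e (8 e
   - 4) = -1. *)
assert (C2 : rel_prime mu e).
{ apply (bezout_coprime _ _ (- (mu + 2 - 8 * e)) (- (8 * e - 4))).
  assert (hv : v = 2 * mu + 1 - 4 * e) by lia. rewrite hv in Ev. lia. }
assert (Hmu3 : mu * mu = 1 \/ mu * mu = 169 * 169).
{ assert (Fin : forall t, mu * mu = t * t * (t * t) -> mu * mu = 1 \/ mu * mu = 169 * 169).
  { intros t Et. destruct (ljunggren v t) as [h|h]; [lia| |]; rewrite Et, h; lia. }
  destruct (Z.le_ge_cases 0 mu) as [h|h].
  - destruct (coprime_mul_square _ _ _ C2 h Ese) as [t [_ Et]].
    apply (Fin t). now rewrite <- Et.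
  - destruct (coprime_mul_square (- mu) (- e) s) as [t [_ Et]]; [|lia|lia|].
    + apply coprime_intro; intros g g1 g2.
      apply (coprime_elim _ _ _ C2); now apply Z.divide_opp_r.
    + apply (Fin t). rewrite <- Et. ring. }
destruct Hmu3 as [Hmu3|Hmu3]; rewrite Hmu3 in HH.
- assert (Br : -1 <= r <= 1) by (clear - HH; nia). assert (Bq : -1 <= q <= 1) by (clear - HH; nia).
  assert (Hr : r = -1 \/ r = 0 \/ r = 1) by lia. assert (Hq : q = -1 \/ q = 0 \/ q = 1) by lia.
  destruct Hr as [-> | [-> | ->]]; destruct Hq as [-> | [-> | ->]]; try lia; simpl; tauto.
- assert (Hmu1 : mu = 169 \/ mu = -169) by (apply square_eq_cases; exact Hmu3).
  assert (Hv1 : v = 239 \/ v = -239) by (apply square_eq_cases; lia).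
  assert (Prod : 2 * (r * q) = mu - nu) by (unfold m in Hmu; lia).
  destruct Hmu1 as [-> | ->]; destruct Hv1 as [-> | ->].
  + assert (h1 : r + q = 130 \/ r + q = -130) by (apply square_eq_cases; rewrite Sum; reflexivity).
    assert (h3 : r - q = 312 \/ r - q = -312) by (apply square_eq_cases; lia).
    assert (h4 : (r = 221 /\ q = -91) \/ (r = -221 /\ q = 91) \/ (r = 91 /\ q = -221)
      \/ (r = -91 /\ q = 221)) by lia.
    destruct h4 as [[-> ->]|[[-> ->]|[[-> ->]|[-> ->]]]]; try (simpl; tauto); lia.
  + exfalso. apply (between_squares (r + q) 312 97682); [lia|rewrite Sum; reflexivity|lia].
  + assert (h1 : r + q = 312 \/ r + q = -312) by (apply square_eq_cases; rewrite Sum; reflexivity).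
    assert (h3 : r - q = 130 \/ r - q = -130) by (apply square_eq_cases; lia).
    assert (h4 : (r = 221 /\ q = 91) \/ (r = -221 /\ q = -91) \/ (r = 91 /\ q = 221)
      \/ (r = -91 /\ q = -221)) by lia.
    destruct h4 as [[-> ->]|[[-> ->]|[[-> ->]|[-> ->]]]]; try (simpl; tauto); lia.
  + exfalso. apply (between_squares (r + q) 128 16562); [lia|rewrite Sum; reflexivity|lia].
Qed.

(** * Periods of the Pell numbers modulo [pellA K] *)

Lemma pell_add (m n : nat) :
  pellA (m + n) = pellA m * pellA n + 2 * (pellB m * pellB n) /\
  pellB (m + n) = pellA m * pellB n + pellB m * pellA n.
Proof.
induction m as [|m [IHA IHB]].
- change (pellA 0) with 1. change (pellB 0) with 0. simpl Nat.add. lia.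
- simpl Nat.add. rewrite !pellA_S, !pellB_S, IHA, IHB. split; ring.
Qed.

Lemma pell_norm_double (n : nat) :
  pellA (n + n) * pellA (n + n) - 2 * (pellB (n + n) * pellB (n + n)) = 1.
Proof.
destruct (pell_add n n) as [-> ->].
assert (N : (pellA n * pellA n - 2 * (pellB n * pellB n))
   * (pellA n * pellA n - 2 * (pellB n * pellB n)) = 1).
{ induction n as [|n IH]; [reflexivity|]. rewrite pellA_S, pellB_S.
  rewrite <- IH. ring. }
rewrite <- N. ring.
Qed.

(* the index K is [k + k] so that the norm of (1 + sqrt 2)^K is 1 *)
Lemma pellA_double (k : nat) : let K := (k + k)%nat in
  pellA (K + K) = 2 * (pellA K * pellA K) - 1 /\
  pellA (K + K) = 4 * (pellB K * pellB K) + 1 /\ pellB (K + K) = 2 * (pellA K * pellB K).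
Proof.
intros K. pose proof (pell_norm_double k) as N. fold K in N.
destruct (pell_add K K) as [-> ->]. lia.
Qed.

(** For even K, (1 + sqrt 2)^(2 K) is -1 modulo [pellA K]. *)
Lemma pellB_antiperiod (k n : nat) : let K := (k + k)%nat in
  exists t, pellB (n + (K + K)) = - pellB n + t * pellA K.
Proof.
intros K. destruct (pell_add n (K + K)) as [_ ->].
destruct (pellA_double k) as [E1 [_ E2]]. fold K in E1, E2. rewrite E1, E2.
exists (2 * pellA n * pellB K + 2 * pellB n * pellA K). ring.
Qed.

Lemma pellB_period (k n j : nat) : let K := (k + k)%nat in
  exists t, pellB (n + j * (K + K + (K + K))) = pellB n + t * pellA K.
Proof.
intros K. induction j as [|j [t IH]].
- exists 0. rewrite Nat.add_0_r. ring.
- set (n' := (n + j * (K + K + (K + K)))%nat) in *.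
  replace (n + S j * (K + K + (K + K)))%nat with (n' + (K + K) + (K + K))%nat
    by (unfold n'; lia).
  destruct (pellB_antiperiod k (n' + (K + K))) as [t1 E1].
  destruct (pellB_antiperiod k n') as [t2 E2]. fold K in E1, E2.
  exists (t + t1 - t2). rewrite E1, E2, IH. ring.
Qed.

Lemma odd_part (n : nat) : (0 < n)%nat -> exists f j, n = (2 ^ f * (2 * j + 1))%nat.
Proof.
induction n as [n IH] using (well_founded_induction lt_wf). intros Hn.
destruct (Nat.Even_or_Odd n) as [[m Hm]|[m Hm]].
- destruct (IH m) as [f [j E]]; [lia|lia|]. exists (S f), j. simpl Nat.pow. lia.
- exists 0%nat, m. simpl; lia.
Qed.

(** * Indices congruent to 4 modulo 3360 *)

Definition double47 (a : Z) : Z := (2 * (a * a) - 1) mod 47.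

Lemma pellA_power2_mod47 (d e : nat) :
  pellA (2 ^ S e * d) mod 47 = Nat.iter e double47 (pellA (2 * d) mod 47).
Proof.
induction e as [|e IH].
- now rewrite Nat.pow_1_r.
- rewrite Nat.iter_succ, <- IH. unfold double47.
  replace (2 ^ S (S e) * d)%nat with (2 ^ e * d + 2 ^ e * d + (2 ^ e * d + 2 ^ e * d))%nat
    by (simpl Nat.pow; lia).
  replace (2 ^ S e * d)%nat with (2 ^ e * d + 2 ^ e * d)%nat by (simpl Nat.pow; lia).
  destruct (pellA_double (2 ^ e * d)) as [-> _].
  rewrite (Zminus_mod (2 * _)), (Zmult_mod 2), (Zmult_mod (pellA _) (pellA _) 47).
  now rewrite <- (Zmult_mod 2), <- Zminus_mod.
Qed.

Lemma iter_periodic (T : Type) (f : T -> T) (x : T) (k r q : nat) :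
  Nat.iter k f x = x -> Nat.iter (r + q * k) f x = Nat.iter r f x.
Proof.
intros E. rewrite Nat.iter_add. f_equal. induction q as [|q IH]; [reflexivity|].
rewrite Nat.mul_succ_l, Nat.add_comm, Nat.iter_add, IH. exact E.
Qed.

(* 2 has order 11 modulo 23, and the Pell numbers have period 46 modulo 47. *)
Lemma some_nonresidue47 (e : nat) : exists d,
  In d [1; 5; 7]%nat /\
  let c := Nat.iter e double47 (pellA (16 * d) mod 47) in
  0 < c /\ Jacobi.quadratic_residue47 c = false.
Proof.
assert (Hr : (e mod 11 < 11)%nat) by (apply Nat.mod_upper_bound; lia).
assert (Check : forallb (fun i => existsb (fun d =>
    let c := Nat.iter i double47 (pellA (16 * d) mod 47) in
    (0 <? c) && negb (Jacobi.quadratic_residue47 c))%bool [1; 5; 7]%nat) (seq 0 11) = true)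
  by (vm_compute; reflexivity).
rewrite forallb_forall in Check. specialize (Check (e mod 11)%nat ltac:(apply in_seq; lia)).
apply existsb_exists in Check. destruct Check as [d [Hd Check]]. exists d. split; [exact Hd|].
assert (Ee : Nat.iter e double47 (pellA (16 * d) mod 47) =
  Nat.iter (e mod 11) double47 (pellA (16 * d) mod 47)).
{ transitivity (Nat.iter (e mod 11 + e / 11 * 11) double47 (pellA (16 * d) mod 47)).
  - f_equal. pose proof (Nat.div_mod_eq e 11); lia.
  - apply iter_periodic.
    destruct Hd as [<-|[<-|[<-|[]]]]; vm_compute; reflexivity. }
cbv zeta in *. rewrite Ee. apply andb_prop in Check. destruct Check as [H1 H2].
split; [now apply Z.ltb_lt|now apply Bool.negb_true_iff].
Qed.

(** Since 3360 = 32 * 105 and d divides 105, the index is 4 plus an odd multiple of 2 K with K = 2^f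
    * 16 d. Modulo M = [pellA K] the Pell number is - 12, so z^2 is - 47. As M is 1 plus a square, M
    would be a square modulo 47, which the choice of d excludes. *)
Lemma class_four (k : nat) (z : Z) : (0 < k)%nat ->
  4 * pellB (4 + 3360 * k) + 1 = z * z -> False.
Proof.
intros Hk E.
destruct (odd_part k Hk) as [f [j Ek]].
destruct (some_nonresidue47 f) as [d [Hd [Hc0 Hc]]].
assert (Hg : exists g, (105 * (2 * j + 1) = d * (2 * g + 1))%nat).
{ destruct Hd as [<-|[<-|[<-|[]]]]; [exists (105 * j + 52)%nat|exists (21 * j + 10)%nat|exists (15 * j + 7)%nat]; lia. }
destruct Hg as [g Hg].
set (k2 := (2 ^ f * (4 * d))%nat).
set (K := (k2 + k2 + (k2 + k2))%nat).
assert (EN : (4 + 3360 * k = 4 + (K + K) + g * (K + K + (K + K)))%nat).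
{ transitivity (4 + 2 ^ f * (32 * (d * (2 * g + 1))))%nat; [rewrite <- Hg, Ek; lia|].
  unfold K, k2. lia. }
rewrite EN in E.
destruct (pellB_period (k2 + k2) (4 + (K + K)) g) as [t1 E1]. fold K in E1.
destruct (pellB_antiperiod (k2 + k2) 4) as [t2 E2]. fold K in E2.
destruct (pellA_double k2) as [_ [E3 _]]. fold K in E3.
change (pellB 4) with 12 in E2. rewrite E2 in E1. rewrite E1 in E.
assert (EK : pellA K mod 47 = Nat.iter f double47 (pellA (16 * d) mod 47)).
{ replace K with (2 ^ S f * (8 * d))%nat by (unfold K, k2; simpl Nat.pow; lia).
  rewrite pellA_power2_mod47. do 2 f_equal. f_equal. lia. }
rewrite <- EK in Hc0, Hc.
set (M := pellA K) in *. set (c := M mod 47) in *.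
assert (HM : M = 47 * (M / 47) + c) by (apply Z_div_mod_eq_full).
assert (c < 47) by (apply Z.mod_pos_bound; lia).
rewrite (Jacobi.neg47_residue_Z M (2 * pellB (k2 + k2)) z (4 * (t1 + t2))
  (pellB (k2 + k2) * pellB (k2 + k2)) (M / 47) c) in Hc; [discriminate|lia|lia|lia|exact HM|lia].
Qed.

(** * Indices divisible by 420 *)

Definition pell5 (n : nat) : Z * Z := (pellA n mod 5, pellB n mod 5).
Definition mul5 (p q : Z * Z) : Z * Z :=
  ((fst p * fst q + 2 * (snd p * snd q)) mod 5, (fst p * snd q + snd p * fst q) mod 5).

Lemma pell5_add (m n : nat) : pell5 (m + n) = mul5 (pell5 m) (pell5 n).
Proof.
unfold pell5, mul5; cbn [fst snd]. destruct (pell_add m n) as [-> ->].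
pose proof (Z_div_mod_eq_full (pellA m) 5) as E1. pose proof (Z_div_mod_eq_full (pellB m) 5) as E2.
pose proof (Z_div_mod_eq_full (pellA n) 5) as E3. pose proof (Z_div_mod_eq_full (pellB n) 5) as E4.
set (a := pellA m mod 5) in *. set (b := pellB m mod 5) in *.
set (c := pellA n mod 5) in *. set (d := pellB n mod 5) in *.
f_equal.
- rewrite <- (Z_mod_plus_full (a * c + 2 * (b * d))
    (pellA m / 5 * pellA n + a * (pellA n / 5) + 2 * (pellB m / 5 * pellB n + b * (pellB n / 5)))).
  f_equal. rewrite E1, E2 at 1. lia.
- rewrite <- (Z_mod_plus_full (a * d + b * c)
    (pellA m / 5 * pellB n + a * (pellB n / 5) + (pellB m / 5 * pellA n + b * (pellA n / 5)))).
  f_equal. rewrite E1, E2 at 1. lia.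
Qed.

(** Modulo 5, squaring exchanges 2 + 2 sqrt 2 and 2 + 3 sqrt 2. *)
Lemma pell5_power2 (f d : nat) : In d [1; 7]%nat ->
  let c := if Nat.even f then 2 else 3 in
  pell5 (2 ^ f * (4 * d)) = (2, c).
Proof.
intros Hd. induction f as [|f IH].
- destruct Hd as [<-|[<-|[]]]; reflexivity.
- cbv zeta in *. replace (2 ^ S f * (4 * d))%nat with (2 ^ f * (4 * d) + 2 ^ f * (4 * d))%nat
    by (simpl Nat.pow; lia).
  rewrite pell5_add, IH, Nat.even_succ, <- Nat.negb_even.
  destruct (Nat.even f); reflexivity.
Qed.

(** Modulo [pellA (K + K)] the shift by 4 K changes the sign, and [pellB] takes the same value at K
    and 3 K; so only g modulo 8 matters. *)
Lemma pellB_odd_multiple (k g : nat) : let K := (k + k)%nat in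
  (((exists i, g = 8 * i + 1 \/ g = 8 * i + 3)%nat ->
    exists t, pellB (K * g) = pellB K + t * pellA (K + K)) /\
   ((exists i, g = 8 * i + 5 \/ g = 8 * i + 7)%nat ->
    exists t, pellB (K * g) = - pellB K + t * pellA (K + K))).
Proof.
intros K.
destruct (pellA_double k) as [E1 [E2 E3]]. fold K in E1, E2, E3.
assert (B3 : pellB (K + K + K) = pellB K + 2 * pellB K * pellA (K + K)).
{ destruct (pell_add (K + K) K) as [_ ->]. rewrite E3.
  transitivity (pellB K * pellA (K + K) + (2 * (pellA K * pellA K)) * pellB K); [ring|].
  replace (2 * (pellA K * pellA K)) with (pellA (K + K) + 1) by lia. ring. }
split; intros [i [-> | ->]].
- destruct (pellB_period K K i) as [t E]. exists t. rewrite <- E. f_equal. lia.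
- destruct (pellB_period K (K + K + K) i) as [t E]. exists (2 * pellB K + t).
  replace (K * (8 * i + 3))%nat with (K + K + K + i * (K + K + (K + K) + (K + K + (K + K))))%nat by lia.
  rewrite E, B3. ring.
- destruct (pellB_period K (K + (K + K + (K + K))) i) as [t E].
  destruct (pellB_antiperiod K K) as [t' E']. exists (t + t').
  replace (K * (8 * i + 5))%nat with
    (K + (K + K + (K + K)) + i * (K + K + (K + K) + (K + K + (K + K))))%nat by lia.
  rewrite E, E'. ring.
- destruct (pellB_period K (K + K + K + (K + K + (K + K))) i) as [t E].
  destruct (pellB_antiperiod K (K + K + K)) as [t' E']. exists (t + t' - 2 * pellB K).
  replace (K * (8 * i + 7))%nat with
    (K + K + K + (K + K + (K + K)) + i * (K + K + (K + K) + (K + K + (K + K))))%nat by lia.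
  rewrite E, E', B3. ring.
Qed.

Lemma pellB_pos (n : nat) : (0 < n)%nat -> 0 < pellB n.
Proof.
destruct n as [|n]; [lia|intros _]. rewrite pellB_S. pose proof (pell_pos n); lia.
Qed.

(** Write 420 k = K g with g odd, B = [pellB K] and M = 4 B^2 + 1. Modulo M, z^2 is 1 + 4 B or 1 - 4
    B, depending on g modulo 8. In the second case 4 B - 1 is a square too, because (2 B)^2 is -1.
    Both 4 B + 1 and 4 B - 1 divide 4 M - 5, so reciprocity makes them squares modulo 5. The parity
    of f tells which of them is not, and d = 1 or d = 7 (that is, g a multiple of 105 or of 15,
    which are 1 and -1 modulo 8) selects the sign needed. *)
Lemma class_zero (k : nat) (z : Z) : (0 < k)%nat ->
  4 * pellB (420 * k) + 1 = z * z -> False.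
Proof.
intros Hk E.
destruct (odd_part k Hk) as [f [j Ek]].
assert (Plus : forall d g, In d [1; 7]%nat -> Nat.even f = false ->
  (420 * k = 2 ^ f * (4 * d) * g)%nat -> (exists i, g = 8 * i + 1 \/ g = 8 * i + 3)%nat -> False).
{ intros d g Hd Hf EN Hg.
  pose proof (pell5_power2 f d Hd) as H5. rewrite Hf in H5.
  set (k2 := (2 ^ f * (2 * d))%nat).
  assert (EK : (2 ^ f * (4 * d) = k2 + k2)%nat) by (unfold k2; lia).
  rewrite EK in H5, EN. destruct (proj1 (pellB_odd_multiple k2 g) Hg) as [t Et].
  destruct (pellA_double k2) as [_ [EA _]].
  set (K := (k2 + k2)%nat) in *. rewrite EN in E.
  assert (HB : 0 < pellB K).
  { apply pellB_pos. unfold K, k2. destruct Hd as [<-|[<-|[]]];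
    assert (2 ^ f <> 0)%nat by (apply Nat.pow_nonzero; lia); lia. }
  assert (Ht : 0 <= t * pellA (K + K)).
  { assert (pellB K <= pellB (K * g)) by (apply pellB_mono; destruct g; lia). lia. }
  injection H5 as _ H5. pose proof (Z_div_mod_eq_full (pellB K) 5) as H5'. rewrite H5 in H5'.
  rewrite EA in Et, Ht. set (B := pellB K) in *. set (b := B / 5) in *.
  apply (Jacobi.square_residue5_Z (4 * B + 1) (4 * (B * B) + 1) (4 * B - 1) z (4 * t)
    (B * B) (2 * B) (4 * b + 2)); try lia; nia. }
assert (Minus : forall d g, In d [1; 7]%nat -> Nat.even f = true ->
  (420 * k = 2 ^ f * (4 * d) * g)%nat -> (exists i, g = 8 * i + 5 \/ g = 8 * i + 7)%nat -> False).
{ intros d g Hd Hf EN Hg.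
  pose proof (pell5_power2 f d Hd) as H5. rewrite Hf in H5.
  set (k2 := (2 ^ f * (2 * d))%nat).
  assert (EK : (2 ^ f * (4 * d) = k2 + k2)%nat) by (unfold k2; lia).
  rewrite EK in H5, EN. destruct (proj2 (pellB_odd_multiple k2 g) Hg) as [t Et].
  destruct (pellA_double k2) as [_ [EA _]].
  set (K := (k2 + k2)%nat) in *. rewrite EN in E.
  assert (HB : 0 < pellB K).
  { apply pellB_pos. unfold K, k2. destruct Hd as [<-|[<-|[]]];
    assert (2 ^ f <> 0)%nat by (apply Nat.pow_nonzero; lia); lia. }
  injection H5 as _ H5. pose proof (Z_div_mod_eq_full (pellB K) 5) as H5'. rewrite H5 in H5'.
  rewrite EA in Et. set (B := pellB K) in *. set (b := B / 5) in *.
  assert (Ex : 2 * B * z * (2 * B * z) = 4 * B - 1 + (z * z - 4 * t) * (4 * (B * B) + 1)).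
  { transitivity ((4 * (B * B) + 1) * (z * z) - z * z); [ring|].
    rewrite <- E at 2. rewrite Et. ring. }
  assert (Ht : 0 <= z * z - 4 * t).
  { apply Z.nlt_ge. intros h.
    pose proof (Z.square_nonneg (2 * B * z)) as h1. pose proof (Z.square_nonneg (2 * B - 1)) as h2.
    assert (h3 : (z * z - 4 * t) * (4 * (B * B) + 1) <= -1 * (4 * (B * B) + 1)).
    { apply Z.mul_le_mono_nonneg_r; lia. }
    lia. }
  apply (Jacobi.square_residue5_Z (4 * B - 1) (4 * (B * B) + 1) (4 * B + 1) (2 * B * z) (z * z - 4 * t)
    (B * B) (2 * B - 1) (4 * b + 1)); try lia; nia. }
destruct (Nat.even f) eqn:Hf.
- assert (Hj : (exists i, j = 4 * i \/ j = 4 * i + 1 \/ j = 4 * i + 2 \/ j = 4 * i + 3)%nat)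
    by (exists (j / 4)%nat; pose proof (Nat.div_mod_eq j 4); pose proof (Nat.mod_upper_bound j 4); lia).
  destruct Hj as [i [Hj|[Hj|[Hj|Hj]]]].
  + apply (Minus 7%nat (15 * (2 * j + 1))%nat); [simpl; tauto|reflexivity|rewrite Ek; lia|exists (15 * i + 1)%nat; lia].
  + apply (Minus 7%nat (15 * (2 * j + 1))%nat); [simpl; tauto|reflexivity|rewrite Ek; lia|exists (15 * i + 5)%nat; lia].
  + apply (Minus 1%nat (105 * (2 * j + 1))%nat); [simpl; tauto|reflexivity|rewrite Ek; lia|exists (105 * i + 65)%nat; lia].
  + apply (Minus 1%nat (105 * (2 * j + 1))%nat); [simpl; tauto|reflexivity|rewrite Ek; lia|exists (105 * i + 91)%nat; lia].
- assert (Hj : (exists i, j = 4 * i \/ j = 4 * i + 1 \/ j = 4 * i + 2 \/ j = 4 * i + 3)%nat)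
    by (exists (j / 4)%nat; pose proof (Nat.div_mod_eq j 4); pose proof (Nat.mod_upper_bound j 4); lia).
  destruct Hj as [i [Hj|[Hj|[Hj|Hj]]]].
  + apply (Plus 1%nat (105 * (2 * j + 1))%nat); [simpl; tauto|reflexivity|rewrite Ek; lia|exists (105 * i + 13)%nat; lia].
  + apply (Plus 1%nat (105 * (2 * j + 1))%nat); [simpl; tauto|reflexivity|rewrite Ek; lia|exists (105 * i + 39)%nat; lia].
  + apply (Plus 7%nat (15 * (2 * j + 1))%nat); [simpl; tauto|reflexivity|rewrite Ek; lia|exists (15 * i + 9)%nat; lia].
  + apply (Plus 7%nat (15 * (2 * j + 1))%nat); [simpl; tauto|reflexivity|rewrite Ek; lia|exists (15 * i + 13)%nat; lia].
Qed.

(** * The sieve for pronic Pell numbers *)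

Definition sieve_primes : list Z := [5; 11; 13; 19; 29; 31; 71; 83; 97; 113; 139; 269; 577; 673].
Definition sieve_modulus : Z := fold_right Z.mul 1 sieve_primes.

(** Multiplication by (1 + sqrt 2)^4 = 17 + 12 sqrt 2; one state modulo the product serves all sieve
    primes. *)
Definition pell_step4 (s : Z * Z) : Z * Z :=
  ((17 * fst s + 24 * snd s) mod sieve_modulus, (12 * fst s + 17 * snd s) mod sieve_modulus).

Fixpoint square_search (p v x : Z) (k : nat) : bool :=
  match k with
  | O => false
  | S l => if x * x mod p =? v then true else square_search p v (x + 1) l
  end.

Definition is_square_mod (p v : Z) : bool := square_search p (v mod p) 0 (Z.to_nat p).

Lemma square_search_true (p v x y : Z) (k : nat) :
  x <= y < x + Z.of_nat k -> y * y mod p = v -> square_search p v x k = true.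
Proof.
revert x. induction k as [|k IH]; intros x Hy E; [lia|]. simpl.
destruct (x * x mod p =? v) eqn:Ex; [reflexivity|].
apply IH; [|exact E]. destruct (Z.eq_dec x y) as [->|]; [|lia].
apply Z.eqb_neq in Ex. contradiction.
Qed.

Lemma is_square_mod_true (p x : Z) : 0 < p -> is_square_mod p (x * x) = true.
Proof.
intros Hp. pose proof (Z.mod_pos_bound x p Hp).
apply (square_search_true _ _ _ (x mod p)); [lia|]. symmetry. apply Zmult_mod.
Qed.

Fixpoint nonsquare_mod_some (ps : list Z) (v : Z) : bool :=
  match ps with
  | [] => false
  | p :: qs => if is_square_mod p v then nonsquare_mod_some qs v else true
  end.

Lemma nonsquare_mod_someP (ps : list Z) (v : Z) : nonsquare_mod_some ps v = true ->
  exists p, In p ps /\ is_square_mod p v = false.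
Proof.
induction ps as [|p qs IH]; [discriminate|]. simpl. destruct (is_square_mod p v) eqn:E.
- intros H. destruct (IH H) as [r [Hr Er]]. exists r; tauto.
- exists p; tauto.
Qed.

(** Nested conditionals keep [vm_compute] from testing squares at exempt indices and from running on
    after a failure. *)
Fixpoint sieve_run (fuel i : nat) (s : Z * Z) : bool :=
  match fuel with
  | O => true
  | S l =>
      if (if ((i =? 1)%nat || (i mod 105 =? 0)%nat)%bool then true
          else nonsquare_mod_some sieve_primes (4 * snd s + 1))
      then sieve_run l (S i) (pell_step4 s) else false
  end.

Lemma sieve_runP (fuel i : nat) (s : Z * Z) : sieve_run fuel i s = true ->
  forall j, (j < fuel)%nat ->
  ((i + j =? 1)%nat || ((i + j) mod 105 =? 0)%nat)%bool = true \/
  exists p, In p sieve_primes /\ is_square_mod p (4 * snd (Nat.iter j pell_step4 s) + 1) = false.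
Proof.
revert i s. induction fuel as [|l IH]; intros i s H j Hj; [lia|]. cbn [sieve_run] in H.
destruct (if ((i =? 1)%nat || (i mod 105 =? 0)%nat)%bool then true else _) eqn:E; [|discriminate].
destruct j as [|j].
- rewrite Nat.add_0_r. destruct ((i =? 1)%nat || (i mod 105 =? 0)%nat)%bool; [now left|right].
  exact (nonsquare_mod_someP _ _ E).
- rewrite Nat.iter_succ_r. replace (i + S j)%nat with (S i + j)%nat by lia. apply IH; [exact H|lia].
Qed.

Lemma pell_state (n : nat) :
  (pellA (4 * n) mod sieve_modulus, pellB (4 * n) mod sieve_modulus) = Nat.iter n pell_step4 (1, 0).
Proof.
induction n as [|n IH]; [reflexivity|].
rewrite Nat.iter_succ, <- IH. unfold pell_step4; cbn [fst snd].
replace (4 * S n)%nat with (4 + 4 * n)%nat by lia.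
destruct (pell_add 4 (4 * n)) as [-> ->].
change (pellA 4) with 17. change (pellB 4) with 12.
set (m := sieve_modulus). set (a := pellA (4 * n)). set (b := pellB (4 * n)).
pose proof (Z_div_mod_eq_full a m) as Ea. pose proof (Z_div_mod_eq_full b m) as Eb.
f_equal.
- rewrite <- (Z_mod_plus_full (17 * (a mod m) + 24 * (b mod m)) (17 * (a / m) + 24 * (b / m))).
  f_equal. lia.
- rewrite <- (Z_mod_plus_full (12 * (a mod m) + 17 * (b mod m)) (12 * (a / m) + 17 * (b / m))).
  f_equal. lia.
Qed.

Lemma sieve (n : nat) (z : Z) : 4 * pellB (4 * n) + 1 = z * z ->
  (exists k, n = 1 + 840 * k)%nat \/ (exists k, n = 105 * k)%nat.
Proof.
intros E.
set (r := (n mod 840)%nat). set (q := (n / 840)%nat).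
assert (En : n = (r + q * 840)%nat) by (pose proof (Nat.div_mod_eq n 840); unfold r, q; lia).
assert (Hr : (r < 840)%nat) by (apply Nat.mod_upper_bound; lia).
clearbody r q.
assert (St : Nat.iter n pell_step4 (1, 0) = Nat.iter r pell_step4 (1, 0)).
(* Modulo every sieve prime, (1 + sqrt 2)^3360 is 1, and 3360 = 4 * 840. *)
{ rewrite En. apply iter_periodic. vm_compute; reflexivity. }
rewrite <- pell_state in St.
assert (Check : sieve_run 840 0 (1, 0) = true) by (vm_compute; reflexivity).
destruct (sieve_runP _ _ _ Check r Hr) as [C|[p [Hp C]]].
- rewrite Nat.add_0_l in C. apply Bool.orb_prop in C. destruct C as [C|C]; apply Nat.eqb_eq in C.
  + left. exists q. lia.
  + right. exists (r / 105 + 8 * q)%nat. pose proof (Nat.div_mod_eq r 105). lia.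
- exfalso. rewrite <- St in C. cbn [snd] in C.
  assert (Hpm : 0 < p /\ exists c, sieve_modulus = c * p).
  { simpl in Hp. repeat destruct Hp as [<-|Hp]; try destruct Hp;
    (split; [lia|]; match goal with |- exists c, _ = c * ?p =>
      exists (sieve_modulus / p); vm_compute; reflexivity end). }
  destruct Hpm as [Hp0 [c Hc]].
  assert (F : is_square_mod p (4 * (pellB (4 * n) mod sieve_modulus) + 1) = is_square_mod p (z * z)).
  { unfold is_square_mod. rewrite <- E.
    replace ((4 * pellB (4 * n) + 1) mod p) with ((4 * (pellB (4 * n) mod sieve_modulus) + 1) mod p);
      [reflexivity|].
    rewrite <- (Z_mod_plus_full _ (4 * c * (pellB (4 * n) / sieve_modulus))). f_equal.
    rewrite (Z_div_mod_eq_full (pellB (4 * n)) sieve_modulus) at 3. rewrite Hc at 3. ring. }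
  rewrite F, is_square_mod_true in C; [discriminate|exact Hp0].
Qed.

Lemma pronic_pell (n : nat) (z : Z) : 4 * pellB (4 * n) + 1 = z * z -> (n <= 1)%nat.
Proof.
intros E. destruct (sieve n z E) as [[k Hk]|[k Hk]].
- destruct k as [|k]; [lia|exfalso]. apply (class_four (S k) z); [lia|].
  rewrite <- E, Hk. do 3 f_equal. lia.
- destruct k as [|k]; [lia|exfalso]. apply (class_zero (S k) z); [lia|].
  rewrite <- E, Hk. do 3 f_equal. lia.
Qed.

(** * The quartics of norm -2 and -1 *)

Lemma quartic_double_minus_one (r q : Z) :
  let m := r * r + 2 * (r * q) - q * q in
  m * m = 2 * (r * r + q * q) - 1 -> r * r + q * q = 1.
Proof.
intros m E.
assert (F : m * m * (m * m) + 1 =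
  2 * ((r * r - 2 * (r * q) - q * q) * (r * r - 2 * (r * q) - q * q))).
{ set (h := r * r + q * q) in *.
  assert (h' : m * m + (r * r - 2 * (r * q) - q * q) * (r * r - 2 * (r * q) - q * q)
    = 2 * (h * h)) by (unfold m, h; ring).
  rewrite E in h' |- *. lia. }
apply biquadrate_plus_one in F. lia.
Qed.

Lemma pellB_add4_mod4 (n : nat) : exists k, pellB (4 + n) = pellB n + 4 * k.
Proof.
exists (3 * pellA n + 4 * pellB n). change (4 + n)%nat with (S (S (S (S n)))).
repeat rewrite ?pellA_S, ?pellB_S. ring.
Qed.

Lemma pellB_mod4 (n : nat) (k : Z) : pellB n = 4 * k -> exists j, n = (4 * j)%nat.
Proof.
revert k. induction n as [n IH] using (well_founded_induction lt_wf). intros k Hk.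
destruct n as [|[|[|[|n]]]].
- now exists 0%nat.
- exfalso. change (pellB 1) with 1 in Hk. lia.
- exfalso. change (pellB 2) with 2 in Hk. lia.
- exfalso. change (pellB 3) with 5 in Hk. lia.
- destruct (pellB_add4_mod4 n) as [i Hi]. change (4 + n)%nat with (S (S (S (S n)))) in Hi.
  destruct (IH n ltac:(lia) (k - i)) as [j Hj]; [lia|]. exists (S j). lia.
Qed.

(** With H = r^2 + q^2 - 1 the companion form gives n^2 - 2 H^2 = 1, so H is a Pell number, and m^2
    = 4 H + 1 makes it pronic. *)
Lemma quartic_four_minus_three (r q : Z) :
  let m := r * r + 2 * (r * q) - q * q in
  m * m = 4 * (r * r + q * q) - 3 -> r * r + q * q = 1 \/ r * r + q * q = 13.
Proof.
intros m E.
set (n := r * r - 2 * (r * q) - q * q).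
set (H := r * r + q * q - 1).
assert (EH : r * r + q * q = H + 1) by (unfold H; ring).
assert (HH : 0 <= H) by (destruct (Z.eq_dec (r * r + q * q) 0) as [e|e];
  [rewrite e in E; nia|unfold H; nia]).
assert (En : n * n = 2 * (H * H) + 1).
{ assert (h : m * m + n * n = 2 * ((H + 1) * (H + 1))) by (rewrite <- EH; unfold m, n; ring).
  rewrite E, EH in h. lia. }
destruct (pell_solutions (Z.abs n) H) as [N [_ HN]]; [lia|exact HH|rewrite Z.abs_square; lia|].
assert (Hm : exists l, m = 2 * l + 1).
{ destruct (Z.Even_or_Odd m) as [[l Hl]|?]; [exfalso; rewrite Hl in E; lia|assumption]. }
destruct Hm as [l Hl].
assert (EHl : H = l * (l + 1)) by (rewrite Hl in E; lia).
(* H is even because it is pronic, and H + 1, a sum of two squares, is not 3 modulo 4. *)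
assert (H4 : exists k, H = 4 * k).
{ assert (Hev : exists k, H = 2 * k).
  { destruct (Z.Even_or_Odd l) as [[i Hi]|[i Hi]].
    - exists (i * (l + 1)). rewrite EHl, Hi. ring.
    - exists (l * (i + 1)). rewrite EHl, Hi. ring. }
  destruct Hev as [k Hk]. destruct (Z.Even_or_Odd k) as [[i Hi]|[i Hi]]; [exists i; lia|exfalso].
  destruct (Z.Even_or_Odd r) as [[r' Hr]|[r' Hr]]; destruct (Z.Even_or_Odd q) as [[q' Hq]|[q' Hq]];
  rewrite Hr, Hq in EH; lia. }
destruct H4 as [k Hk].
destruct (pellB_mod4 N k) as [j Hj]; [lia|].
rewrite Hj in HN.
assert (Hj1 : (j <= 1)%nat) by (apply (pronic_pell j m); rewrite <- HN; lia).
destruct j as [|[|j]]; [left|right|lia].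
- change (pellB (4 * 0)) with 0 in HN. lia.
- change (pellB (4 * 1)) with 12 in HN. lia.
Qed.

(** * The candidates for y = a b and the points they give *)

Definition point_list : list (Z * Z) :=
  [(0, 0); (1, 1); (-1, -1); (1, 0); (-1, 0); (1, -2); (-1, 2); (5, 3); (-5, -3);
   (0, 1); (0, -1); (2, 1); (-2, -1); (2, 0); (-2, 0); (2, 2); (-2, -2);
   (182, -130); (-182, 130); (442, 312); (-442, -312)].

(** Modulo 4 the equation for m^2 leaves N = 2 or N = -2 when p is even and N = -1 when p is odd.
    The substitutions p = 2 k, q = R + k and p = R + q lead to the quartics. *)
Lemma square_plus_double_square_norm (p q N : Z) :
  (p * p + 2 * (q * q) - 2) * (p * p + 2 * (q * q) - 2)
    - 2 * ((2 * (p * q) - 1) * (2 * (p * q) - 1)) = N ->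
  Z.abs N = 1 \/ Z.abs N = 2 -> In (p, q) point_list.
Proof.
intros E HN.
set (m := p * p - 2 * (q * q)).
assert (Em : m * m = 4 * ((p - q) * (p - q) + q * q) - 2 + N)
  by (rewrite <- E; unfold m; ring).
destruct (Z.Even_or_Odd p) as [[k Hk]|[k Hk]].
- set (R := q - k).
  assert (ER : m = - (2 * (R * R + 2 * (R * k) - k * k)))
    by (unfold m, R; rewrite Hk; ring).
  set (M := R * R + 2 * (R * k) - k * k) in *.
  assert (EM : 4 * (M * M) = 8 * (R * R + k * k) - 2 + N).
  { transitivity (m * m); [rewrite ER; ring|rewrite Em]. unfold R; rewrite Hk; ring. }
  assert (HN2 : N = 2 \/ N = -2) by lia.
  destruct HN2 as [-> | ->].
  + assert (Hin := quartic_double R k ltac:(cbv zeta; fold M; lia)).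
    assert (Eq : q = R + k) by (unfold R; ring).
    rewrite Hk, Eq. clearbody R. clear - Hin.
    repeat destruct Hin as [Hin|Hin]; try (injection Hin as <- <-; vm_compute; tauto).
    destruct Hin.
  + assert (S1 := quartic_double_minus_one R k ltac:(cbv zeta; fold M; lia)).
    assert (Eq : q = R + k) by (unfold R; ring).
    rewrite Hk, Eq. clearbody R. clear - S1.
    assert (-1 <= R <= 1) by nia. assert (-1 <= k <= 1) by nia.
    assert (H1 : R = -1 \/ R = 0 \/ R = 1) by lia. assert (H2 : k = -1 \/ k = 0 \/ k = 1) by lia.
    destruct H1 as [-> | [-> | ->]]; destruct H2 as [-> | [-> | ->]]; try lia; vm_compute; tauto.
- assert (Om : m = 2 * (2 * (k * k) + 2 * k - q * q) + 1) by (unfold m; rewrite Hk; ring).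
  assert (HN1 : N = -1).
  { set (h := (p - q) * (p - q) + q * q) in *. rewrite Om in Em. lia. }
  subst N. set (R := p - q) in *.
  assert (ER : m = R * R + 2 * (R * q) - q * q) by (unfold m, R; ring).
  rewrite HN1 in Em. rewrite ER in Em.
  assert (S1 := quartic_four_minus_three R q ltac:(cbv zeta; lia)).
  assert (Ep : p = R + q) by (unfold R; ring).
  rewrite Ep. clearbody R. clear - S1 Em.
  assert (B1 : -3 <= R <= 3) by nia. assert (B2 : -3 <= q <= 3) by nia.
  assert (H1 : R = -3 \/ R = -2 \/ R = -1 \/ R = 0 \/ R = 1 \/ R = 2 \/ R = 3) by lia.
  assert (H2 : q = -3 \/ q = -2 \/ q = -1 \/ q = 0 \/ q = 1 \/ q = 2 \/ q = 3) by lia.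
  destruct H1 as [-> | [-> | [-> | [-> | [-> | [-> | ->]]]]]];
  destruct H2 as [-> | [-> | [-> | [-> | [-> | [-> | ->]]]]]]; try lia; vm_compute; tauto.
Qed.

(* The pair (m, n) stands for m + n sqrt 2. *)
Definition zmul (x y : Z * Z) : Z * Z :=
  (fst x * fst y + 2 * (snd x * snd y), fst x * snd y + snd x * fst y).
Definition zopp (x : Z * Z) : Z * Z := (- fst x, - snd x).
Definition zsucc (x : Z * Z) : Z * Z := (fst x + 1, snd x).

Lemma zmul_opp_opp (x : Z * Z) : zmul (zopp x) (zopp x) = zmul x x.
Proof. unfold zmul, zopp; cbn [fst snd]; f_equal; ring. Qed.

Definition curve_points : list ((Z * Z) * (Z * Z)) :=
  [((-1, 0), (-1, -1)); ((-1, 1), (1, 1)); ((13, 9), (-7, 5)); ((31, -22), (-41, -29));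
   ((1, 0), (0, 1)); ((1, -1), (-4, -3)); ((-2, -1), (-2, 1)); ((4, -3), (-10, -7));
   ((-61828, -43719), (-66922, 47321)); ((-149266, 105547), (-390050, -275807))].

Lemma curve_points_complete (a b : Z * Z) :
  zmul (zsucc (zmul (zmul a a) b)) b = (2, 1) ->
  (a = (0, 0) /\ b = (2, 1)) \/
  exists c, In (c, b) curve_points /\ (a = c \/ a = zopp c).
Proof.
destruct a as [a1 a2], b as [b1 b2]. unfold zmul, zsucc; cbn [fst snd]. intros E.
apply pair_equal_spec in E. destruct E as [E1 E2].
set (p := a1 * b1 + 2 * (a2 * b2)). set (q := a1 * b2 + a2 * b1).
assert (Hb1 : b1 = 2 - (p * p + 2 * (q * q))).
{ enough (b1 + (p * p + 2 * (q * q)) = 2) by lia.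
  etransitivity; [|exact E1]. unfold p, q; ring. }
assert (Hb2 : b2 = 1 - 2 * (p * q)).
{ enough (b2 + 2 * (p * q) = 1) by lia. etransitivity; [|exact E2]. unfold p, q; ring. }
set (e1 := (a1 * a1 + 2 * (a2 * a2)) * b1 + 2 * ((a1 * a2 + a2 * a1) * b2) + 1) in *.
set (e2 := (a1 * a1 + 2 * (a2 * a2)) * b2 + (a1 * a2 + a2 * a1) * b1) in *.
(* Norms are multiplicative, and 2 + w has norm 2. *)
assert (HN : (b1 * b1 - 2 * (b2 * b2)) * (e1 * e1 - 2 * (e2 * e2)) = 2).
{ transitivity ((e1 * b1 + 2 * (e2 * b2)) * (e1 * b1 + 2 * (e2 * b2))
    - 2 * ((e1 * b2 + e2 * b1) * (e1 * b2 + e2 * b1))); [ring|]. rewrite E1, E2. reflexivity. }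
assert (Hin : In (p, q) point_list).
{ apply (square_plus_double_square_norm p q (b1 * b1 - 2 * (b2 * b2))).
  - rewrite Hb1, Hb2. ring.
  - set (N := b1 * b1 - 2 * (b2 * b2)) in *.
    assert (D : (N | 2)) by (exists (e1 * e1 - 2 * (e2 * e2)); lia).
    apply Z.divide_abs_l in D. apply Z.divide_pos_le in D; [|lia].
    assert (N <> 0) by (intros h; rewrite h in HN; lia). lia. }
assert (Hp : p = a1 * b1 + 2 * (a2 * b2)) by reflexivity.
assert (Hq : q = a1 * b2 + a2 * b1) by reflexivity.
clearbody p q. clear E1 E2 HN e1 e2.
repeat destruct Hin as [Hin|Hin]; [injection Hin as <- <-..|destruct Hin];
  cbn in Hb1, Hb2; subst b1 b2;
  [left; split; f_equal; lia | right ..].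
(* The entries of [curve_points] have distinct b, so filtering on b finds the one to compare with.
   Then a b = y is a linear system that determines a. *)
all: match goal with |- exists c, In (c, ?b) _ /\ _ =>
  let l := eval cbn in (filter (fun z => (fst (snd z) =? fst b) && (snd (snd z) =? snd b))%bool curve_points) in
  match l with [(?c, _)] => exists c end end.
all: (split; [simpl; tauto|]).
all: (first [left; unfold zopp; cbn [fst snd]; f_equal; lia|right; unfold zopp; cbn [fst snd]; f_equal; lia]).
Qed.

Lemma curve_points_sound (a b : Z * Z) : In (a, b) curve_points ->
  zmul (zsucc (zmul (zmul a a) b)) b = (2, 1).
Proof.
intros H. simpl in H.
repeat destruct H as [H|H]; [injection H as <- <-; reflexivity..|destruct H].
Qed.

End Equations.

(** * The ring Z[sqrt 2] inside R *)

From Stdlib Require Import ZArith.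
From mathcomp Require Import all_boot all_order all_algebra.
From mathcomp Require Import ring zify ssrZ.
Import Equations.
Import GRing.Theory Num.Theory.
Local Open Scope ring_scope.

Lemma sqrt2_irrational (m n : nat) : (m * m = 2 * (n * n))%N -> n = 0%N.
Proof.
move=> E; case: (posnP n) => // n0.
have m0 : (0 < m)%N by case: (posnP m) => // m0; move: E; rewrite m0; nia.
have := congr1 (logn 2) E; rewrite !lognM ?muln_gt0 ?n0 //.
by rewrite -[logn 2 2]/1%N; lia.
Qed.

Section Embedding.

Variable R : rcfType.

Let w : R := Num.sqrt 2.
Let u : R := w + 1.

Let iZ (z : Z) : R := (int_of_Z z)%:~R.

Lemma iZD (a b : Z) : iZ (Z.add a b) = iZ a + iZ b.
Proof. by rewrite /iZ -intrD -rmorphD. Qed.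

Lemma iZM (a b : Z) : iZ (Z.mul a b) = iZ a * iZ b.
Proof. by rewrite /iZ -intrM -rmorphM. Qed.

Lemma iZN (a : Z) : iZ (Z.opp a) = - iZ a.
Proof. by rewrite /iZ -rmorphN -rmorphN. Qed.

Definition zw (x : Z * Z) : R := iZ x.1 + iZ x.2 * w.

Lemma ww : w * w = 2.
Proof. by rewrite -expr2 sqr_sqrtr // ler0n. Qed.

Lemma int_sqrt2_free (m n : int) : m%:~R + n%:~R * w = 0 -> m = 0 /\ n = 0.
Proof.
move=> E; have Ew : m%:~R = - (n%:~R * w) by apply/eqP; rewrite -addr_eq0 E.
have : (m * m)%:~R = (2 * (n * n))%:~R :> R.
  rewrite intrM Ew mulrNN; transitivity (n%:~R * n%:~R * (w * w)); first by ring.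
  by rewrite ww; ring.
move/intr_inj => Emn.
have n0 : n = 0.
  have : (`|m| * `|m| = 2 * (`|n| * `|n|))%N by rewrite -!abszM Emn !abszM.
  by move/sqrt2_irrational; lia.
by split=> //; move: Emn; rewrite n0; nia.
Qed.

Lemma zw_inj : injective zw.
Proof.
move=> [m n] [k l]; rewrite /zw /iZ /= => E.
have [h1 h2] : int_of_Z m - int_of_Z k = 0 /\ int_of_Z n - int_of_Z l = 0.
  apply: int_sqrt2_free; rewrite !intrB.
  transitivity ((int_of_Z m)%:~R + (int_of_Z n)%:~R * w -
    ((int_of_Z k)%:~R + (int_of_Z l)%:~R * w)); first by ring.
  by rewrite E subrr.
by congr pair; apply: (can_inj int_of_ZK); apply/eqP; rewrite -subr_eq0 ?h1 ?h2.
Qed.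

Lemma zwM (x y : Z * Z) : zw (zmul x y) = zw x * zw y.
Proof.
case: x y => [a b] [c d]; rewrite /zw /zmul; cbn [fst snd]; rewrite !(iZD, iZM).
have -> : iZ (Zpos (xO xH)) = 2 by [].
transitivity (iZ a * iZ c + iZ b * iZ d * (w * w) + (iZ a * iZ d + iZ b * iZ c) * w).
  by rewrite ww; ring.
by ring.
Qed.

Lemma zw_succ (x : Z * Z) : zw (zsucc x) = zw x + 1.
Proof. by rewrite /zw /zsucc; cbn [fst snd]; rewrite iZD -[iZ (Zpos xH)]/(1 : R); ring. Qed.

Lemma zw_opp (x : Z * Z) : zw (zopp x) = - zw x.
Proof. by rewrite /zw /zopp; cbn [fst snd]; rewrite !iZN; ring. Qed.

Lemma zwX (x : Z * Z) (n : nat) :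
  zw (Nat.iter n (zmul x) (Zpos xH, Z0)) = zw x ^+ n.
Proof.
elim: n => [|n IH]; first by rewrite expr0 /zw /= -[iZ (Zpos xH)]/(1 : R) -[iZ Z0]/(0 : R) mul0r addr0.
by rewrite [Nat.iter _ _ _]/(zmul x (Nat.iter n (zmul x) (Zpos xH, Z0))) zwM IH exprS.
Qed.

Definition zadd (x y : Z * Z) : Z * Z := (Z.add x.1 y.1, Z.add x.2 y.2).

Lemma zwD (x y : Z * Z) : zw (zadd x y) = zw x + zw y.
Proof. by rewrite /zw /zadd; cbn [fst snd]; rewrite !iZD; ring. Qed.

Lemma zw_nat (n : nat) : n%:R = zw (Z.of_nat n, Z0).
Proof.
rewrite /zw /= -[iZ Z0]/(0 : R) mul0r addr0.
by elim: n => // n IH; rewrite Nat2Z.inj_succ -Z.add_1_r iZD -IH -[iZ (Zpos xH)]/(1 : R) natr1.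
Qed.

Lemma Zsqrt2P (x : R) : Zsqrt2 x <-> exists z, x = zw z.
Proof.
split=> [[m [n ->]]|[z ->]]; last by exists (int_of_Z z.1), (int_of_Z z.2).
by exists (Z_of_int m, Z_of_int n); rewrite /zw /iZ /= !Z_of_intK.
Qed.

Let zu : Z * Z := (Zpos xH, Zpos xH).
Let zv : Z * Z := (Zneg xH, Zpos xH).
Let zs : Z * Z := (Z0, Zpos xH).

Lemma uE : u = zw zu. Proof. by rewrite /u /zw /= /iZ /= mul1r addrC. Qed.
Lemma wE : w = zw zs. Proof. by rewrite /zw /= /iZ /= mul1r add0r. Qed.

Lemma uvE : u * zw zv = 1.
Proof. by rewrite uE -zwM /zw /= /iZ /= mul0r addr0. Qed.

Lemma uVE : u^-1 = zw zv.
Proof.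
have u0 : u != 0 by apply/eqP => u0; move: uvE; rewrite u0 mul0r => /esym/eqP; rewrite oner_eq0.
by apply: (mulfI u0); rewrite divff // uvE.
Qed.

Lemma zw_1 : 1 = zw (Zpos xH, Z0). Proof. exact: (zw_nat 1). Qed.

Lemma zw_0 : 0 = zw (Z0, Z0). Proof. exact: (zw_nat 0). Qed.

Lemma uX (n : nat) : u ^+ n = zw (Nat.iter n (zmul zu) (Zpos xH, Z0)).
Proof. by rewrite zwX uE. Qed.

Lemma uVX (n : nat) : (u ^+ n)^-1 = zw (Nat.iter n (zmul zv) (Zpos xH, Z0)).
Proof. by rewrite zwX -uVE exprVn. Qed.

Lemma curveE (a b : Z * Z) : on_curve (2 + w) (zw a) (zw b) <->
  zmul (zsucc (zmul (zmul a a) b)) b = (Zpos (xO xH), Zpos xH).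
Proof.
rewrite /on_curve expr2 -!zwM -zw_succ -zwM.
have -> : 2 + w = zw (Zpos (xO xH), Zpos xH) by rewrite /zw /= /iZ /= mul1r.
by split=> [/zw_inj ->|->].
Qed.

End Embedding.

Lemma mem_map_In (T : eqType) (A : Type) (f : A -> T) (y : T) (l : list A) :
  y \in [seq f x | x <- l] <-> exists2 x, List.In x l & y = f x.
Proof.
elim: l => [|a l IH]; first by split=> // -[x []].
rewrite /= inE; split.
  case/orP => [/eqP ->|/IH [x xl ->]]; [by exists a => //; left|by exists x => //; right].
case=> x [<- ->|xl E]; first by rewrite eqxx.
by apply/orP; right; apply/IH; exists x.
Qed.

(* [zw] is generalised so that conversion only computes with pairs of integers. *)
Ltac zw_compute := rewrite ?uVX ?uVE ?uX ?uE ?wE ?zw_nat ?zw_1 ?zw_0;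
  lazymatch goal with |- context [zw ?R _] =>
    let f := fresh "f" in let fM := fresh "fM" in let fN := fresh "fN" in let fD := fresh "fD" in
    generalize (zw R) (zwM R) (zw_opp R) (zwD R); intros f fM fN fD;
    rewrite -?(fM, fN, fD) end.

Theorem theorem8p11 (R : rcfType) :
  let w : R := Num.sqrt 2 in
  let u : R := w + 1 in
  [/\ 2 + w = u * w,
      (forall a b : R,
        Zsqrt2_point (2 + w) a b <->
        (a, b) = (0, w * u) \/
        exists2 p : R * R,
          p \in [:: (- 1, - u);
                    (w - 1, u);
                    (13 + 9 * w, 1 / u ^+ 3);
                    (31 - 22 * w, - u ^+ 5);
                    (1, w);
                    (1 - w, - w * u ^+ 2);
                    (- 2 - w, - w / u);
                    (4 - 3 * w, - w * u ^+ 3);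
                    (- 13 * w * u ^+ 10, - w / u ^+ 13);
                    (- 13 * w / u ^+ 11, - w * u ^+ 15)]
          & (a, b) = (p.1, p.2) \/ (a, b) = (- p.1, p.2))
    & [/\ w - 1 = 1 / u,
          13 + 9 * w = (3 + w) * u ^+ 2
        & 31 - 22 * w = - (3 - w) / u ^+ 3] /\
      [/\ 1 - w = - 1 / u,
          - 2 - w = - w * u
        & 4 - 3 * w = - w / u ^+ 2]].
Proof.
move=> w u.
(* Every listed point is the image of a pair of integer coordinates, after which only integer
   computations remain. *)
have points : [:: (- 1, - u); (w - 1, u); (13 + 9 * w, 1 / u ^+ 3); (31 - 22 * w, - u ^+ 5);
    (1, w); (1 - w, - w * u ^+ 2); (- 2 - w, - w / u); (4 - 3 * w, - w * u ^+ 3);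
    (- 13 * w * u ^+ 10, - w / u ^+ 13); (- 13 * w / u ^+ 11, - w * u ^+ 15)]
  = [seq (zw R x.1, zw R x.2) | x <- curve_points].
  by rewrite !div1r /u /w; zw_compute.
split.
- by rewrite /u /w; zw_compute.
- move=> a b; rewrite points; split.
    case=> /Zsqrt2P [x ->] /Zsqrt2P [y ->] /curveE /curve_points_complete [[-> ->]|[c [cL cE]]].
      by left; rewrite /u /w; zw_compute.
    right; exists (zw R c, zw R y); first by apply/mem_map_In; exists (c, y).
    by case: cE => ->; [left|right; rewrite zw_opp].
  have pt (x y : Z * Z) : zmul (zsucc (zmul (zmul x x) y)) y = (Zpos (xO xH), Zpos xH) ->
    Zsqrt2_point (2 + w) (zw R x) (zw R y).
    by move=> H; split; [apply/Zsqrt2P; exists x|apply/Zsqrt2P; exists y|apply/curveE].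
  case=> [[-> ->]|[p /mem_map_In [[x y] xL ->]]].
    have -> : (0 : R) = zw R (Z0, Z0) by exact: (zw_nat R 0).
    have -> : w * u = zw R (Zpos (xO xH), Zpos xH) by rewrite /u /w; zw_compute.
    exact: pt.
  have H := curve_points_sound x y xL.
  by case=> -[-> ->] /=; [apply: pt|rewrite -zw_opp; apply: pt; rewrite zmul_opp_opp].
- by split; split; rewrite /u /w ?div1r; zw_compute.
Qed.
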